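(* Let $F:\mathcal{C}\to\mathcal{D}$ be a normal tensor functor between fusion categories over a field $\Bbbk$, and denote by $R$ its right adjoint. Let $A_1,\dots,A_l$ denote the equivalence classes of $\approx^F$ in $\Lambda_{\mathcal{C}}$. (1) For $X\in A_i$, $$\frac{F_![X]}{\mathrm{FPdim}(X)}=\frac{F_!(\mathrm{R}_{A_i})}{\mathrm{FPdim}(\mathrm{R}_{A_i})}.$$ (2) For $X,X'\in\Lambda_{\mathcal{C}}$, $$X\approx^F X'\iff\frac{F_![X]}{\mathrm{FPdim}(X)}=\frac{F_![X']}{\mathrm{FPdim}(X')}.$$ Now assume in addition that $F$ is dominant, and let $B_1,\dots,B_l$ be the equivalence classes of $\approx_F$ in $\Lambda_{\mathcal{D}}$, indexed so that $B_i=A_i^F$. Then: (3) For $Y\in B_i$, $$\frac{R_![Y]}{\mathrm{FPdim}(Y)}=[\mathcal{C}:\mathcal{D}]\,\frac{\mathrm{R}_{A_i}}{\mathrm{FPdim}(\mathrm{R}_{A_i})}.$$ (4) For $Y,Y'\in\Lambda_{\mathcal{D}}$, $$Y\approx_F Y'\iff\frac{R_![Y]}{\mathrm{FPdim}(Y)}=\frac{R_![Y']}{\mathrm{FPdim}(Y')}.$$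
   Context: A fusion category over a field $\Bbbk$ is a $\Bbbk$-linear semisimple rigid monoidal category with finitely many isomorphism classes of simple objects, finite dimensional Hom spaces, such that $\mathrm{End}(S)=\Bbbk$ for every simple object $S$, and whose unit object $\mathbf{1}$ is simple. $\Lambda_{\mathcal{C}}$ is the set of isomorphism classes of simple objects. ''Factor'' means direct summand. An object is trivial if isomorphic to $\mathbf{1}^n$ for some $n\in\mathbb{N}$. A tensor functor is a strong monoidal $\Bbbk$-linear functor; between fusion categories it has a right adjoint. $F$ is dominant if every $Y\in\Lambda_{\mathcal{D}}$ is a factor of $F(X)$ for some $X\in\Lambda_{\mathcal{C}}$. $F$ is normal if for every $X\in\Lambda_{\mathcal{C}}$ such that $F(X)$ contains $\mathbf{1}$ as a factor, $F(X)$ is trivial. $K_0(\mathcal{C})=\bigoplus_{X\in\Lambda_{\mathcal{C}}}\mathbb{Z}[X]$ is the Grothendieck ring and $K_0(\mathcal{C})_{\mathbb{C}}=K_0(\mathcal{C})\otimes_{\mathbb{Z}}\mathbb{C}$. For simple $X$, $\mathrm{FPdim}(X)>0$ is the Frobenius-Perron eigenvalue of left multiplication by $[X]$ on $K_0(\mathcal{C})$, extended linearly to an algebra morphism $\mathrm{FPdim}:K_0(\mathcal{C})_{\mathbb{C}}\to\mathbb{C}$. For $A\subset\Lambda_{\mathcal{C}}$, $\mathrm{R}_A=\sum_{X\in A}\mathrm{FPdim}(X)[X]$. $\mathrm{FPdim}(\mathcal{C})=\sum_{X\in\Lambda_{\mathcal{C}}}\mathrm{FPdim}(X)^2$, and $[\mathcal{C}:\mathcal{D}]=\mathrm{FPdim}(\mathcal{C})/\mathrm{FPdim}(\mathcal{D})$.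 For a $\Bbbk$-linear functor $G:\mathcal{C}\to\mathcal{C}'$ between fusion categories, $G_!:K_0(\mathcal{C})_{\mathbb{C}}\to K_0(\mathcal{C}')_{\mathbb{C}}$ is the linear map with $G_![X]=\sum_{Y\in\Lambda_{\mathcal{C}'}}\dim_{\Bbbk}\mathrm{Hom}(Y,G(X))\,[Y]$. For $X\in\Lambda_{\mathcal{C}}$, $X^F=\{Y\in\Lambda_{\mathcal{D}}\mid Y\text{ is a factor of }F(X)\}$; for $A\subset\Lambda_{\mathcal{C}}$, $A^F=\bigcup_{X\in A}X^F$. For $Y\in\Lambda_{\mathcal{D}}$, $Y_F=\{X\in\Lambda_{\mathcal{C}}\mid Y\text{ is a factor of }F(X)\}$. On $\Lambda_{\mathcal{C}}$, $X\sim^F X'\iff X^F\cap X'^F\neq\emptyset$, and $\approx^F$ is the transitive closure of $\sim^F$ (an equivalence relation). On $\Lambda_{\mathcal{D}}$, $Y\sim_F Y'\iff Y_F\cap Y'_F\neq\emptyset$, and, when $F$ is dominant, $\approx_F$ is the transitive closure of $\sim_F$ (an equivalence relation). When $F$ is dominant, $A\mapsto A^F$ is a bijection from the set of $\approx^F$-classes to the set of $\approx_F$-classes. *)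

(* Defs.v *)
From Stdlib Require Import Relation_Operators.
From mathcomp Require Import all_boot all_order all_algebra.
From mathcomp Require Import complex.
From mathcomp Require Import boolp classical_sets reals.
(* [finset] comes last so that [set0], [setT] and the set notations denote
   finite sets rather than classical ones. *)
From mathcomp Require Import finset.

Set Implicit Arguments.
Unset Strict Implicit.
Unset Printing Implicit Defensive.

Import Order.TTheory GRing.Theory Num.Theory.
Local Open Scope ring_scope.
Local Open Scope complex_scope.

Declare Scope cat_scope.
Delimit Scope cat_scope with cat.
Local Open Scope cat_scope.

Reserved Notation "X \ot Y" (at level 40, left associativity).
Reserved Notation "f \otm g" (at level 40, left associativity).

(* Finite dimensionality of the Hom spaces is carried by [vectType]. *)
Record linCat (k : fieldType) := LinCat {
  obj :> Type;
  hom : obj -> obj -> vectType k;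
  idm : forall X, hom X X;
  comp : forall X Y Z, hom Y Z -> hom X Y -> hom X Z;
  comp_linearr : forall X Y Z (g : hom Y Z), linear (@comp X Y Z g);
  comp_linearl : forall X Y Z (f : hom X Y), linear ((@comp X Y Z)^~ f);
  compA : forall W X Y Z (h : hom Y Z) (g : hom X Y) (f : hom W X),
    comp h (comp g f) = comp (comp h g) f;
  compm1 : forall X Y (f : hom X Y), comp f (idm X) = f;
  comp1m : forall X Y (f : hom X Y), comp (idm Y) f = f
}.

Arguments hom {k l} X Y : rename.
Arguments idm {k l} X : rename.
Arguments comp {k l X Y Z} g f : rename.

Notation "g \o f" := (comp g f) : cat_scope.

Section LinCatTheory.
Context (k : fieldType) (C : linCat k).
Implicit Types (X Y Z S V : C).

Definition is_iso X Y (f : hom X Y) : Prop :=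
  exists g : hom Y X, g \o f = idm X /\ f \o g = idm Y.

Definition isomorphic X Y : Prop := exists f : hom X Y, is_iso f.

Definition mono X Y (f : hom X Y) : Prop :=
  forall W (g h : hom W X), f \o g = f \o h -> g = h.

Definition epi X Y (f : hom X Y) : Prop :=
  forall W (g h : hom Y W), g \o f = h \o f -> g = h.

Definition is_kernel X Y (f : hom X Y) K (i : hom K X) : Prop :=
  f \o i = 0 /\
  forall W (g : hom W X), f \o g = 0 -> exists! h : hom W K, i \o h = g.

Definition is_cokernel X Y (f : hom X Y) Q (p : hom Y Q) : Prop :=
  p \o f = 0 /\
  forall W (g : hom Y W), g \o f = 0 -> exists! h : hom Q W, h \o p = g.

Definition zero_obj X : Prop := idm X = 0.

(* For [I] empty this says that [V] is a zero object. *)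
Definition is_direct_sum (I : finType) (S : I -> C) V : Prop :=
  exists (inc : forall j, hom (S j) V) (prj : forall j, hom V (S j)),
    [/\ forall j, prj j \o inc j = idm (S j),
        forall j j', j != j' -> prj j \o inc j' = 0
      & \sum_j (inc j \o prj j) = idm V].

Definition is_factor Y V : Prop :=
  exists Z, is_direct_sum (fun b : bool => if b then Y else Z) V.

Record abelian_cat : Prop := AbelianCat {
  has_direct_sums : forall n (S : 'I_n -> C), exists V, is_direct_sum S V;
  has_kernels : forall X Y (f : hom X Y), exists K (i : hom K X), is_kernel f i;
  has_cokernels :
    forall X Y (f : hom X Y), exists Q (p : hom Y Q), is_cokernel f p;
  mono_normal :
    forall X Y (i : hom X Y), mono i -> exists Z (f : hom Y Z), is_kernel f i;
  epi_normal :
    forall X Y (p : hom X Y), epi p -> exists Z (f : hom Z X), is_cokernel f p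
}.

Definition simple_obj S : Prop :=
  ~ zero_obj S /\
  forall W (i : hom W S), mono i -> zero_obj W \/ is_iso i.

Definition semisimple_cat : Prop :=
  abelian_cat /\
  forall V, exists n (S : 'I_n -> C),
    (forall j, simple_obj (S j)) /\ is_direct_sum S V.

End LinCatTheory.

Record monCat (k : fieldType) := MonCat {
  mon_lin :> linCat k;
  one : mon_lin;
  tens : mon_lin -> mon_lin -> mon_lin;
  tensm : forall X X' Y Y' : mon_lin,
    hom X X' -> hom Y Y' -> hom (tens X Y) (tens X' Y');
  assoc : forall X Y Z, hom (tens (tens X Y) Z) (tens X (tens Y Z));
  assoc_inv : forall X Y Z, hom (tens X (tens Y Z)) (tens (tens X Y) Z);
  lunit : forall X, hom (tens one X) X;
  runit : forall X, hom (tens X one) X;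
  tensm_linearr : forall X X' Y Y' (f : hom X X'),
    linear (@tensm X X' Y Y' f);
  tensm_linearl : forall X X' Y Y' (g : hom Y Y'),
    linear ((@tensm X X' Y Y')^~ g);
  tensm_id : forall X Y, tensm (idm X) (idm Y) = idm (tens X Y);
  tensm_comp : forall X X' X'' Y Y' Y''
      (f' : hom X' X'') (f : hom X X') (g' : hom Y' Y'') (g : hom Y Y'),
    tensm (f' \o f) (g' \o g) = tensm f' g' \o tensm f g;
  assocK : forall X Y Z, assoc_inv X Y Z \o assoc X Y Z = idm _;
  assoc_invK : forall X Y Z, assoc X Y Z \o assoc_inv X Y Z = idm _;
  lunit_iso : forall X, is_iso (lunit X);
  runit_iso : forall X, is_iso (runit X);
  assoc_nat : forall X X' Y Y' Z Z'
      (f : hom X X') (g : hom Y Y') (h : hom Z Z'),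
    assoc X' Y' Z' \o tensm (tensm f g) h =
    tensm f (tensm g h) \o assoc X Y Z;
  lunit_nat : forall X X' (f : hom X X'),
    lunit X' \o tensm (idm one) f = f \o lunit X;
  runit_nat : forall X X' (f : hom X X'),
    runit X' \o tensm f (idm one) = f \o runit X;
  pentagon : forall W X Y Z,
    tensm (idm W) (assoc X Y Z) \o assoc W (tens X Y) Z
      \o tensm (assoc W X Y) (idm Z) =
    assoc W X (tens Y Z) \o assoc (tens W X) Y Z;
  triangle : forall X Y,
    tensm (idm X) (lunit Y) \o assoc X one Y = tensm (runit X) (idm Y)
}.

Arguments one {k} m.
Arguments tens {k m} X Y : rename.
Arguments tensm {k m X X' Y Y'} f g : rename.
Arguments assoc {k m} X Y Z : rename.
Arguments assoc_inv {k m} X Y Z : rename.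
Arguments lunit {k m} X : rename.
Arguments runit {k m} X : rename.

Notation "X \ot Y" := (tens X Y) : cat_scope.
Notation "f \otm g" := (tensm f g) : cat_scope.

Section Rigid.
Context (k : fieldType) (C : monCat k).

Definition is_dual_pair (X Y : C)
    (ev : hom (Y \ot X) (one C)) (coev : hom (one C) (X \ot Y)) : Prop :=
  runit X \o (idm X \otm ev) \o assoc X Y X \o (coev \otm idm X) = lunit X /\
  lunit Y \o (ev \otm idm Y) \o assoc_inv Y X Y \o (idm Y \otm coev) = runit Y.

Definition is_left_dual (X Y : C) : Prop :=
  exists (ev : hom (Y \ot X) (one C)) (coev : hom (one C) (X \ot Y)),
    is_dual_pair ev coev.

Definition rigid : Prop :=
  forall X : C, (exists Y, is_left_dual X Y) /\ (exists Z, is_left_dual Z X).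

Definition is_trivial (V : C) : Prop :=
  exists n : nat, is_direct_sum (fun _ : 'I_n => one C) V.

End Rigid.

(* The set Lambda of isomorphism classes of simple objects is the finite type
   [Irr], each class being given with a chosen representative. *)
Record fusionCat (k : fieldType) := FusionCat {
  fus_mon :> monCat k;
  Irr : finType;
  irr : Irr -> fus_mon;
  fus_semisimple : semisimple_cat fus_mon;
  fus_rigid : rigid fus_mon;
  irr_simple : forall x, simple_obj (irr x);
  irr_inj : forall x y, isomorphic (irr x) (irr y) -> x = y;
  irr_surj : forall S : fus_mon, simple_obj S -> exists x, isomorphic S (irr x);
  fus_End : forall S : fus_mon, simple_obj S ->
    bijective (fun a : k => a *: idm S);
  one_simple : simple_obj (one fus_mon)
}.

Arguments Irr {k} f.
Arguments irr {k f} x : rename.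

Record linFunctor (k : fieldType) (C D : linCat k) := LinFunctor {
  fobj :> C -> D;
  fmap : forall X Y, hom X Y -> hom (fobj X) (fobj Y);
  fmap_linear : forall X Y, linear (@fmap X Y);
  fmap_id : forall X, fmap (idm X) = idm (fobj X);
  fmap_comp : forall X Y Z (g : hom Y Z) (f : hom X Y),
    fmap (g \o f) = fmap g \o fmap f
}.

Arguments fmap {k C D} F {X Y} f : rename.

Record tensorFunctor (k : fieldType) (C D : monCat k) := TensorFunctor {
  tf_lin :> linFunctor C D;
  tf2 : forall X Y : C, hom (tf_lin X \ot tf_lin Y) (tf_lin (X \ot Y));
  tf0 : hom (one D) (tf_lin (one C));
  tf2_iso : forall X Y, is_iso (tf2 X Y);
  tf0_iso : is_iso tf0;
  tf2_nat : forall X X' Y Y' (f : hom X X') (g : hom Y Y'),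
    tf2 X' Y' \o (fmap tf_lin f \otm fmap tf_lin g) =
    fmap tf_lin (f \otm g) \o tf2 X Y;
  tf2_assoc : forall X Y Z,
    fmap tf_lin (assoc X Y Z) \o tf2 (X \ot Y) Z
      \o (tf2 X Y \otm idm (tf_lin Z)) =
    tf2 X (Y \ot Z) \o (idm (tf_lin X) \otm tf2 Y Z)
      \o assoc (tf_lin X) (tf_lin Y) (tf_lin Z);
  tf_lunit : forall X,
    fmap tf_lin (lunit X) \o tf2 (one C) X \o (tf0 \otm idm (tf_lin X)) =
    lunit (tf_lin X);
  tf_runit : forall X,
    fmap tf_lin (runit X) \o tf2 X (one C) \o (idm (tf_lin X) \otm tf0) =
    runit (tf_lin X)
}.

Definition is_right_adjoint (k : fieldType) (C D : linCat k)
    (F : linFunctor C D) (G : linFunctor D C) : Prop :=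
  exists phi : forall (X : C) (Y : D), hom (F X) Y -> hom X (G Y),
    [/\ forall X Y, bijective (phi X Y),
        forall X X' Y (f : hom X' X) (h : hom (F X) Y),
          phi X' Y (h \o fmap F f) = phi X Y h \o f
      & forall X Y Y' (g : hom Y Y') (h : hom (F X) Y),
          phi X Y' (g \o h) = fmap G g \o phi X Y h].

Section NormalFunctors.
Context (k : fieldType) (C D : fusionCat k) (F : tensorFunctor C D).

Definition dominant : Prop :=
  forall Y : Irr D, exists X : Irr C, is_factor (irr Y) (F (irr X)).

Definition normal : Prop :=
  forall X : Irr C, is_factor (one D) (F (irr X)) -> is_trivial (F (irr X)).

Definition up1 (X : Irr C) : {set Irr D} :=
  [set Y | `[< is_factor (irr Y) (F (irr X)) >]].

Definition up (A : {set Irr C}) : {set Irr D} := \bigcup_(X in A) up1 X.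

Definition down1 (Y : Irr D) : {set Irr C} :=
  [set X | `[< is_factor (irr Y) (F (irr X)) >]].

Definition sim_up : rel (Irr C) := fun X X' => up1 X :&: up1 X' != set0.

Definition sim_down : rel (Irr D) := fun Y Y' => down1 Y :&: down1 Y' != set0.

Definition approx_up : rel (Irr C) :=
  fun X X' => `[< clos_trans (Irr C) sim_up X X' >].

Definition approx_down : rel (Irr D) :=
  fun Y Y' => `[< clos_trans (Irr D) sim_down Y Y' >].

End NormalFunctors.

Definition enumerates_classes (T : finType) (e : rel T) (l : nat)
    (A : 'I_l -> {set T}) : Prop :=
  injective A /\
  [set A i | i : 'I_l] = equivalence_partition e [set: T].

(* The complexified Grothendieck group, as coordinates in the basis of classes
   of simple objects; [R[i]] is the field of complex numbers over [R]. *)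
Notation K0 R C := {ffun Irr C -> R[i]^o}.

Section Grothendieck.
Context (R : realType) (k : fieldType) (C : fusionCat k).

(* The multiplicity of a simple object Y in V is dim Hom(Y, V), as
   End(Y) = k. *)
Definition K0class (V : C) : K0 R C :=
  [ffun Y => (\dim (fullv : {vspace hom (irr Y) V}))%:R].

Definition K0basis (X : Irr C) : K0 R C := [ffun Y => (Y == X)%:R].

Definition K0mul (u v : K0 R C) : K0 R C :=
  \sum_X \sum_Y (u X * v Y) *: K0class (irr X \ot irr Y).

(* The Frobenius-Perron eigenvalue is the largest nonnegative real
   eigenvalue. *)
Definition FPdim_irr (X : Irr C) : R :=
  sup (fun a : R => 0 <= a /\
    exists v : K0 R C, v != 0 /\ K0mul (K0basis X) v = a%:C *: v).

Definition FPdim (v : K0 R C) : R[i] := \sum_X v X * (FPdim_irr X)%:C.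

Definition FPdim_cat : R := \sum_(X : Irr C) FPdim_irr X ^+ 2.

Definition regular_elt (A : {set Irr C}) : K0 R C :=
  \sum_(X in A) (FPdim_irr X)%:C *: K0basis X.

End Grothendieck.

Arguments FPdim_irr R {k C} X.
Arguments FPdim_cat R {k} C.
Arguments K0basis R {k C} X.
Arguments regular_elt R {k C} A.

Definition FPindex (R : realType) (k : fieldType) (C D : fusionCat k) : R :=
  FPdim_cat R C / FPdim_cat R D.

Definition pushforward (R : realType) (k : fieldType) (C D : fusionCat k)
    (G : linFunctor C D) (v : K0 R C) : K0 R D :=
  \sum_X v X *: K0class R (G (irr X)).

(* Main.v *)
(* A normal tensor functor F acts on simple objects through the matrix f X Y = [F X : Y]; its
   Gram matrix M = f f^T is, by duality, multiplication by kappa = sum_t [F t : 1] t. Normality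
   gives M f = n f and M d = n d, where n = sum_t [F t : 1]^2 and d is the vector of
   Frobenius-Perron dimensions. Hence every column of f, divided by d, is harmonic for the
   conductances M X Z d X d Z, so it is constant on the classes of the relation generated by
   M X Z <> 0. When F is dominant, F_! R_C is a positive eigenvector of left multiplication by
   itself in K_0(D), as is R_D, so the two are proportional, which fixes the scalars in the
   formula for R_!. The Frobenius-Perron dimensions are identified with the unique positive
   character of the fusion ring, which exists by Perron's theorem. *)

Require Import Defs.
From HB Require Import structures.
From Stdlib Require Import Relation_Operators.
From mathcomp Require Import all_boot all_order all_algebra.
From mathcomp Require Import complex.
From mathcomp Require Import boolp classical_sets reals.
From mathcomp Require Import topology normedtype derive.
From mathcomp Require Import ring.
From mathcomp Require Import finset.

(* [hom] and other names of [Defs] are shadowed by the mathcomp libraries. *)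
Import Defs.

Set Implicit Arguments.
Unset Strict Implicit.
Unset Printing Implicit Defensive.

Import Order.TTheory GRing.Theory Num.Theory numFieldNormedType.Exports.
Local Open Scope ring_scope.

(** * Linear categories *)

(** Only dimensions enter the matrix f, so duality is used through a single equality, dim Hom(Y \ot
    A, B) = dim Hom(A, X \ot B), needed for a dual pair in C and for its image under F. In the image
    pair F(1) stands in place of the unit and coherence isomorphisms are inserted; this is why dual
    pairs are relaxed below to pairs whose zigzags are merely invertible. The equation M f = n f
    comes from multiplicativity of f: the term of kappa at t multiplies the image of x by [F t : 1]
    times the class of F t, and normality replaces F t by [F t : 1] copies of the unit, which leaves
    [F t : 1]^2. The equation M d = n d has the same proof, d being the pullback of the dimensions
    of D. [FPdim_irr] is a supremum of eigenvalues with complex eigenvectors, which is awkward in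
    algebra; the argument runs with an abstract positive character, and the supremum is identified
    with it afterwards. *)

Section LinearDimension.
Context (k : fieldType).

Lemma linear_map0 (V W : lmodType k) (f : V -> W) : linear f -> f 0 = 0.
Proof.
by move=> f_lin; have := f_lin (-1) 0 0; rewrite scaler0 addr0 scaleN1r addNr.
Qed.

Lemma linear_mapD (V W : lmodType k) (f : V -> W) :
  linear f -> forall u v, f (u + v) = f u + f v.
Proof. by move=> f_lin u v; have := f_lin 1 u v; rewrite !scale1r. Qed.

Lemma linear_map_sum (V W : lmodType k) (f : V -> W) :
  linear f -> forall (I : finType) (u : I -> V), f (\sum_i u i) = \sum_i f (u i).
Proof.
move=> f_lin I u.
by rewrite (big_morph f (linear_mapD f_lin) (linear_map0 f_lin)).
Qed.

Lemma dim_linear_inj (V W : vectType k) (f : V -> W) :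
  linear f -> (forall v, f v = 0 -> v = 0) -> (dim V <= dim W)%N.
Proof.
move=> f_lin f_inj.
pose ff : {linear V -> W} := HB.pack f (GRing.isLinear.Build _ _ _ _ _ f_lin).
have kerf : (fullv :&: lker (linfun ff) = 0)%VS.
  apply/eqP; rewrite -subv0; apply/subvP => v.
  rewrite memv_cap memv_ker lfunE /= => /andP[_ /eqP /f_inj ->].
  exact: mem0v.
by rewrite -!dimvf -(limg_dim_eq kerf) dimvS ?subvf.
Qed.

Lemma dim_linear_can (V W : vectType k) (f : V -> W) (g : W -> V) :
  linear f -> linear g -> cancel f g -> cancel g f -> dim V = dim W.
Proof.
have can_eq0 (U U' : vectType k) (h : U -> U') h' :
    linear h -> linear h' -> cancel h h' -> forall v, h v = 0 -> v = 0.
  move=> _ h'_lin hK v hv0; rewrite -(hK v) hv0.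
  exact: linear_map0.
move=> f_lin g_lin fK gK; apply/eqP; rewrite eqn_leq; apply/andP; split.
  exact: dim_linear_inj f_lin (can_eq0 _ _ _ _ f_lin g_lin fK).
exact: dim_linear_inj g_lin (can_eq0 _ _ _ _ g_lin f_lin gK).
Qed.

Lemma dim_direct_sum (I : finType) (U : I -> vectType k) (V : vectType k)
    (a : forall i, U i -> V) (b : forall i, V -> U i) :
  (forall i, linear (a i)) -> (forall i, linear (b i)) ->
  (forall i, cancel (a i) (b i)) ->
  (forall i j u, i != j -> b i (a j u) = 0) ->
  (forall v, \sum_i a i (b i v) = v) ->
  dim V = (\sum_i dim (U i))%N.
Proof.
move=> a_lin b_lin aK ab0 sum_ab.
pose la i : {linear U i -> V} :=
  HB.pack (a i) (GRing.isLinear.Build _ _ _ _ _ (a_lin i)).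
pose W i := (limg (linfun (la i)))%VS.
have dimW i : \dim (W i) = dim (U i).
  rewrite -dimvf; apply: limg_dim_eq.
  apply/eqP; rewrite -subv0; apply/subvP => v.
  rewrite memv_cap memv_ker lfunE /= => /andP[_ /eqP av0].
  by rewrite memv0 -(aK i v) av0 (linear_map0 (b_lin i)).
have memWP i v : v \in W i -> exists u, v = a i u.
  by case/memv_imgP => u _; rewrite lfunE /= => ->; exists u.
have -> : dim V = \dim (\sum_i W i).
  rewrite -dimvf; congr (\dim _); apply/esym/eqP; rewrite eqEsubv subvf /=; apply/subvP.
  move=> v _; rewrite -(sum_ab v) memv_sumr // => i _.
  by apply/memv_imgP; exists (b i v); rewrite ?memvf // lfunE.
have /directvP -> /= : directv (\sum_i W i).
  apply/directv_sum_independent => us usW us0 i _.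
  have [u usi] := memWP i _ (usW i isT).
  have := congr1 (b i) us0.
  rewrite (linear_map0 (b_lin i)) (linear_map_sum (b_lin i)) (bigD1 i) //= big1 ?addr0.
    by rewrite usi aK => ->; exact: (linear_map0 (a_lin i)).
  move=> j ji; have [v ->] := memWP j _ (usW j isT).
  by rewrite ab0 // eq_sym.
by apply: eq_bigr => i _; rewrite dimW.
Qed.

End LinearDimension.

Local Open Scope cat_scope.

Section LinCatLemmas.
Context (k : fieldType) (C : linCat k).
Implicit Types (X Y Z S V W : C).

Definition hdim X Y : nat := dim (hom X Y).

Lemma compm0 X Y Z (g : hom Y Z) : g \o (0 : hom X Y) = 0.
Proof. exact: linear_map0 (comp_linearr g). Qed.

Lemma comp0m X Y Z (f : hom X Y) : (0 : hom Y Z) \o f = 0.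
Proof. exact: linear_map0 (comp_linearl f). Qed.

Lemma comp_sumr (I : finType) X Y Z (g : hom Y Z) (f : I -> hom X Y) :
  g \o (\sum_i f i) = \sum_i (g \o f i).
Proof. exact: linear_map_sum (comp_linearr g) _ _. Qed.

Lemma comp_suml (I : finType) X Y Z (g : I -> hom Y Z) (f : hom X Y) :
  (\sum_i g i) \o f = \sum_i (g i \o f).
Proof. exact: linear_map_sum (comp_linearl f) _ _. Qed.

Lemma is_iso_id X : is_iso (idm X).
Proof. by exists (idm X); rewrite compm1. Qed.

Lemma is_iso_comp X Y Z (g : hom Y Z) (f : hom X Y) :
  is_iso g -> is_iso f -> is_iso (g \o f).
Proof.
move=> [g' [g'g gg']] [f' [f'f ff']]; exists (f' \o g'); split.
  by rewrite compA -(compA f') g'g compm1.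
by rewrite compA -(compA g) ff' compm1.
Qed.

Lemma isomorphic_sym X Y : isomorphic X Y -> isomorphic Y X.
Proof. by case=> f [g [gf fg]]; exists g, f. Qed.

Lemma isomorphic_trans X Y Z :
  isomorphic X Y -> isomorphic Y Z -> isomorphic X Z.
Proof.
by case=> f f_iso [g g_iso]; exists (g \o f); apply: is_iso_comp.
Qed.

Lemma iso_epi X Y Z (f : hom X Y) (g h : hom Y Z) :
  is_iso f -> g \o f = h \o f -> g = h.
Proof.
by case=> f' [_ ff'] e; rewrite -(compm1 g) -(compm1 h) -ff' !compA e.
Qed.

Lemma iso_mono X Y Z (f : hom Y Z) (g h : hom X Y) :
  is_iso f -> f \o g = f \o h -> g = h.
Proof.
by case=> f' [f'f _] e; rewrite -(comp1m g) -(comp1m h) -f'f -!compA e.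
Qed.

Lemma hdim_direct_sumr (I : finType) (S : I -> C) V W :
  is_direct_sum S V -> hdim W V = (\sum_i hdim W (S i))%N.
Proof.
case=> inc [prj [prj_inc prj_inc0 sum_inc]].
apply: (dim_direct_sum (a := fun i => comp (inc i))
                       (b := fun i => comp (prj i))) => [i|i|i u|i j u ij|u].
- exact: comp_linearr.
- exact: comp_linearr.
- by rewrite compA prj_inc comp1m.
- by rewrite compA prj_inc0 // comp0m.
- by under eq_bigr do rewrite compA; rewrite -comp_suml sum_inc comp1m.
Qed.

Lemma hdim_direct_suml (I : finType) (S : I -> C) V W :
  is_direct_sum S V -> hdim V W = (\sum_i hdim (S i) W)%N.
Proof.
case=> inc [prj [prj_inc prj_inc0 sum_inc]].
apply: (dim_direct_sum (a := fun i => (@comp _ _ _ _ W)^~ (prj i))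
          (b := fun i => (@comp _ _ _ _ W)^~ (inc i))) => [i|i|i u|i j u ij|u].
- exact: comp_linearl.
- exact: comp_linearl.
- by rewrite -compA prj_inc compm1.
- by rewrite -compA prj_inc0 ?compm0 // eq_sym.
- by under eq_bigr do rewrite -compA; rewrite -comp_sumr sum_inc compm1.
Qed.

Lemma hdim_isor X Y W : isomorphic X Y -> hdim W X = hdim W Y.
Proof.
case=> f [g [gf fg]].
apply: (dim_linear_can (f := comp f) (g := comp g)) => [||u|u].
- exact: comp_linearr.
- exact: comp_linearr.
- by rewrite compA gf comp1m.
- by rewrite compA fg comp1m.
Qed.

Lemma hdim_isol X Y W : isomorphic X Y -> hdim X W = hdim Y W.
Proof.
case=> f [g [gf fg]].
apply: (dim_linear_can (f := (@comp _ _ _ _ W)^~ g)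
                       (g := (@comp _ _ _ _ W)^~ f)) => [||u|u].
- exact: comp_linearl.
- exact: comp_linearl.
- by rewrite -compA gf compm1.
- by rewrite -compA fg compm1.
Qed.

Lemma hdim_gt0 X Y (f : hom X Y) : f <> 0 -> (0 < hdim X Y)%N.
Proof.
move=> f0; rewrite lt0n; apply/negP => /eqP d0; apply: f0.
by apply/eqP; rewrite -memv0 -(_ : fullv = 0%VS) ?memvf //; apply/eqP;
  rewrite -dimv_eq0 dimvf; apply/eqP.
Qed.

Lemma hdim_neq0 X Y : (0 < hdim X Y)%N -> exists f : hom X Y, f <> 0.
Proof.
move=> d0; exists (vpick fullv); apply/eqP.
by rewrite vpick0 -dimv_eq0 dimvf -lt0n.
Qed.

Lemma direct_sum_iso (I : finType) (S T : I -> C) V :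
  (forall i, isomorphic (S i) (T i)) -> is_direct_sum S V -> is_direct_sum T V.
Proof.
move=> /(_ _)/cid-/all_sig[f /(_ _)/cid-/all_sig[g gK]].
case=> inc [prj [prj_inc prj_inc0 sum_inc]].
exists (fun i => inc i \o g i), (fun i => f i \o prj i); split=> [i|i j ij|].
- by rewrite compA -(compA (f i)) prj_inc compm1; case: (gK i).
- by rewrite compA -(compA (f i)) prj_inc0 // compm0 comp0m.
- rewrite -sum_inc; apply: eq_bigr => i _.
  by rewrite compA -(compA (inc i)); case: (gK i) => -> _; rewrite compm1.
Qed.

Lemma factor_hdim_gt0 Y V : idm Y <> 0 -> is_factor Y V -> (0 < hdim Y V)%N.
Proof.
move=> Y0 [Z [inc [prj [prj_inc _ _]]]]; apply: (hdim_gt0 (f := inc true)).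
by move=> i0; apply: Y0; rewrite -(prj_inc true) i0 compm0.
Qed.

(** The complement is the kernel of the retraction [g]: the idempotent [idm V - (f \o g)] factors
    through it, and that factorization is the second projection. *)
Lemma split_mono_factor Y V (f : hom Y V) (g : hom V Y) :
  abelian_cat C -> g \o f = idm Y -> is_factor Y V.
Proof.
move=> abC gf; pose e : hom V V := idm V - (f \o g).
have compBr X1 X2 X3 (a : hom X2 X3) (b c : hom X1 X2) :
    a \o (b - c) = (a \o b) - (a \o c).
  by rewrite -scaleN1r addrC comp_linearr scaleN1r addrC.
have compBl X1 X2 X3 (a : hom X1 X2) (b c : hom X2 X3) :
    (b - c) \o a = (b \o a) - (c \o a).
  by rewrite -scaleN1r addrC comp_linearl scaleN1r addrC.
have [Z [i [gi0 i_univ]]] := has_kernels abC g.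
have [p [ip _]] : exists! p : hom V Z, i \o p = e.
  by apply: i_univ; rewrite compBr compm1 compA gf comp1m subrr.
have i_mono W (a b : hom W Z) : i \o a = i \o b -> a = b.
  move=> iab; have [c [_ c_uniq]] : exists! c : hom W Z, i \o c = i \o a.
    by apply: i_univ; rewrite compA gi0 comp0m.
  by rewrite -(c_uniq a) // -(c_uniq b).
exists Z.
exists (fun b => if b as b0 return hom (if b0 then Y else Z) V then f else i).
exists (fun b => if b as b0 return hom V (if b0 then Y else Z) then g else p).
split=> [[]|[] []|] //=.
- apply: i_mono; rewrite compA ip compBl comp1m -compA gi0 compm0 subr0.
  by rewrite compm1.
- move=> _; apply: i_mono.
  by rewrite compA ip compBl comp1m -compA gf compm1 subrr compm0.
- by rewrite big_bool /= ip addrC subrK.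
Qed.

(** The kernel of [f] is a subobject of the simple [X], and not all of it since [f <> 0]. So [f] is
    mono, and a nonzero subobject of the simple [Y] is all of [Y]. *)
Lemma schur X Y (f : hom X Y) :
  abelian_cat C -> simple_obj X -> simple_obj Y -> f <> 0 -> is_iso f.
Proof.
move=> abC [X0 Xsub] [_ Ysub] f0.
have [K [i [fi0 i_univ]]] := has_kernels abC f.
have i_mono : mono i.
  move=> W a b iab; have [c [_ c_uniq]] : exists! c : hom W K, i \o c = i \o a.
    by apply: i_univ; rewrite compA fi0 comp0m.
  by rewrite -(c_uniq a) // -(c_uniq b).
case: (Xsub K i i_mono) => [K0|[j [_ ij]]]; last first.
  by case: f0; rewrite -(compm1 f) -ij compA fi0 comp0m.
have f_mono : mono f.
  move=> W a b fab.
  have [c [ic _]] : exists! c : hom W K, i \o c = a - b.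
    apply: i_univ; rewrite -scaleN1r addrC comp_linearr fab scaleN1r.
    exact: addNr.
  by apply/eqP; rewrite -subr_eq0 -ic -(comp1m c) K0 comp0m compm0.
by case: (Ysub X f f_mono).
Qed.

End LinCatLemmas.

(** * Multiplicities in fusion categories *)

Section Multiplicity.
Context (k : fieldType) (C : fusionCat k).
Implicit Types (V W S : C) (X Y : Irr C).

Definition mult X V : nat := hdim (irr X) V.

Lemma fus_abelian : abelian_cat C.
Proof. by case: (fus_semisimple C). Qed.

Lemma simple_idm S : simple_obj S -> idm S <> 0.
Proof. by case. Qed.

Lemma hdim_simple S : simple_obj S -> hdim S S = 1%N.
Proof.
move=> /fus_End[g fK gK].
rewrite -[RHS](_ : dim k^o = 1%N) //; symmetry.
apply: (dim_linear_can (f := fun a : k^o => a *: idm S) (g := g)) => //.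
  by move=> a u v; rewrite scalerDl scalerA.
move=> a u v; apply: (can_inj fK); rewrite gK scalerDl -scalerA !gK.
by [].
Qed.

Lemma hdim_simple_neq S S' :
  simple_obj S -> simple_obj S' -> ~ isomorphic S S' -> hdim S S' = 0%N.
Proof.
move=> S_simple S'_simple SS'; apply/eqP; rewrite -leqn0 leqNgt.
apply/negP => /hdim_neq0[f f0]; apply: SS'; exists f.
exact: schur fus_abelian S_simple S'_simple f0.
Qed.

Lemma mult_irr X Y : mult X (irr Y) = (X == Y).
Proof.
have [->|XY] := eqVneq X Y; first exact/hdim_simple/irr_simple.
apply: hdim_simple_neq; [exact: irr_simple..|] => /irr_inj.
exact/eqP.
Qed.

Lemma irr_decomposition V :
  exists n (x : 'I_n -> Irr C), is_direct_sum (fun j => irr (x j)) V.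
Proof.
have [_ /(_ V)[n [S [S_simple S_sum]]]] := fus_semisimple C.
have [x Sx] : exists x : 'I_n -> Irr C, forall j, isomorphic (S j) (irr (x j)).
  apply: (fin_all_exists (U := fun=> Irr C)
    (P := fun j x => isomorphic (S j) (irr x))) => j.
  exact: irr_surj.
by exists n, x; apply: direct_sum_iso S_sum.
Qed.

(** Stands for an additive function on the Grothendieck group. The expansions over simple objects
    below (of Hom, of either tensor factor, of [F]) are instances of [additive_dimE]. *)
Definition additive_dim (h : C -> nat) : Prop :=
  forall n (S : 'I_n -> C) V, is_direct_sum S V -> h V = (\sum_i h (S i))%N.

Lemma additive_dimE (h : C -> nat) V :
  additive_dim h -> h V = (\sum_X mult X V * h (irr X))%N.
Proof.
move=> h_add; have [n [x Vx]] := irr_decomposition V.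
rewrite (h_add _ _ _ Vx).
under [RHS]eq_bigr => X _.
  rewrite /mult (hdim_direct_sumr _ Vx) big_distrl /=.
  under eq_bigr do rewrite -/(mult _ _) mult_irr.
  over.
rewrite exchange_big /=; apply: eq_bigr => j _.
rewrite (bigD1 (x j)) //= eqxx mul1n big1 ?addn0 // => X /negPf -> //.
Qed.

Lemma hdimE V W : hdim V W = (\sum_X mult X V * mult X W)%N.
Proof.
have W_add : additive_dim (fun U : C => hdim U W).
  by move=> n S U; apply: hdim_direct_suml.
exact: additive_dimE V W_add.
Qed.

(** Semisimplicity and one-dimensional endomorphism spaces turn both sides into the same sum of
    products of multiplicities. A multiplicity can thus be read from maps into or out of a simple
    object. *)
Lemma hdimC V W : hdim V W = hdim W V.
Proof. by rewrite !hdimE; under eq_bigr do rewrite mulnC. Qed.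

(** A nonzero map from [S] to [V] has a nonzero component in some simple summand of [V]. By Schur
    this component is invertible, which yields a retraction of the map. *)
Lemma simple_factorP S V : simple_obj S -> is_factor S V <-> (0 < hdim S V)%N.
Proof.
move=> S_simple; split; first exact/factor_hdim_gt0/simple_idm.
case/hdim_neq0=> f f0.
have [n [x [inc [prj [_ _ sum_inc]]]]] := irr_decomposition V.
have [j pf0] : exists j, prj j \o f <> 0.
  apply: contrapT => pf0; apply: f0; rewrite -(comp1m f) -sum_inc comp_suml.
  apply: big1 => j _; rewrite -compA; have [->|nz] := pselect (prj j \o f = 0).
    exact: compm0.
  by case: pf0; exists j.
have [g [gpf _]] := schur fus_abelian S_simple (irr_simple _) pf0.
by apply: (split_mono_factor fus_abelian (f := f) (g := g \o prj j)); rewrite -compA.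
Qed.

Lemma irr_factorP X V : is_factor (irr X) V <-> (0 < mult X V)%N.
Proof. exact/simple_factorP/irr_simple. Qed.

End Multiplicity.

(** * Duality *)

Lemma is_iso_cancell (k : fieldType) (C : linCat k) (X Y Z : C)
    (g : hom Y Z) (f : hom X Y) :
  is_iso g -> is_iso (g \o f) -> is_iso f.
Proof.
move=> g_iso gf_iso; have [g' [g'g gg']] := g_iso.
rewrite (_ : f = g' \o (g \o f)); last by rewrite compA g'g comp1m.
by apply: is_iso_comp gf_iso; exists g.
Qed.

Lemma comp_rewrite (k : fieldType) (C : linCat k) (X Y Y' Z : C)
    (g : hom Y Z) (f : hom X Y) (g' : hom Y' Z) (f' : hom X Y') :
  g \o f = g' \o f' ->
  forall W (r : hom W X), g \o (f \o r) = g' \o (f' \o r).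
Proof. by move=> e W r; rewrite !compA e. Qed.

Lemma comp_cancel (k : fieldType) (C : linCat k) (X Y : C)
    (g : hom Y X) (f : hom X Y) :
  g \o f = idm X -> forall W (r : hom W X), g \o (f \o r) = r.
Proof. by move=> e W r; rewrite compA e comp1m. Qed.

Section Monoidal.
Context (k : fieldType) (C : monCat k).
Implicit Types (X Y U V W A B : C).

Lemma tensm0 X X' Y Y' (f : hom X X') : f \otm (0 : hom Y Y') = 0.
Proof. exact: linear_map0 (tensm_linearr f). Qed.

Lemma tens0m X X' Y Y' (g : hom Y Y') : (0 : hom X X') \otm g = 0.
Proof. exact: linear_map0 (tensm_linearl g). Qed.

Lemma tensm_compr X Y Y' Y'' (g' : hom Y' Y'') (g : hom Y Y') :
  idm X \otm (g' \o g) = (idm X \otm g') \o (idm X \otm g).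
Proof. by rewrite -tensm_comp compm1. Qed.

Lemma tensm_compl X X' X'' Y (f' : hom X' X'') (f : hom X X') :
  (f' \o f) \otm idm Y = (f' \otm idm Y) \o (f \otm idm Y).
Proof. by rewrite -tensm_comp compm1. Qed.

Lemma tensm_swap X X' Y Y' (f : hom X X') (g : hom Y Y') :
  (f \otm idm Y') \o (idm X \otm g) = (idm X' \otm g) \o (f \otm idm Y).
Proof. by rewrite -!tensm_comp !compm1 !comp1m. Qed.

Lemma is_iso_tensm X X' Y Y' (f : hom X X') (g : hom Y Y') :
  is_iso f -> is_iso g -> is_iso (f \otm g).
Proof.
move=> [f' [f'f ff']] [g' [g'g gg']]; exists (f' \otm g').
by rewrite -!tensm_comp f'f ff' g'g gg' !tensm_id.
Qed.

Lemma assoc_iso X Y Z : is_iso (assoc X Y Z : hom _ _).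
Proof.
by exists (assoc_inv X Y Z); rewrite assocK assoc_invK.
Qed.

Lemma assoc_inv_nat X X' Y Y' Z Z' (f : hom X X') (g : hom Y Y') (h : hom Z Z') :
  assoc_inv X' Y' Z' \o (f \otm (g \otm h)) =
  ((f \otm g) \otm h) \o assoc_inv X Y Z.
Proof.
apply: (iso_epi (assoc_iso X Y Z)); rewrite -!compA assocK compm1.
by rewrite -assoc_nat compA assocK comp1m.
Qed.

Lemma direct_sum_tensl (I : finType) (S : I -> C) V W :
  is_direct_sum S V -> is_direct_sum (fun i => S i \ot W) (V \ot W).
Proof.
case=> inc [prj [prj_inc prj_inc0 sum_inc]].
exists (fun i => inc i \otm idm W), (fun i => prj i \otm idm W).
split=> [i|i j ij|]; rewrite -?tensm_compl ?prj_inc ?tensm_id //.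
  by rewrite prj_inc0 // tens0m.
under eq_bigr do rewrite -tensm_compl.
by rewrite -(linear_map_sum (tensm_linearl (idm W))) sum_inc tensm_id.
Qed.

Lemma direct_sum_tensr (I : finType) (S : I -> C) V W :
  is_direct_sum S V -> is_direct_sum (fun i => W \ot S i) (W \ot V).
Proof.
case=> inc [prj [prj_inc prj_inc0 sum_inc]].
exists (fun i => idm W \otm inc i), (fun i => idm W \otm prj i).
split=> [i|i j ij|]; rewrite -?tensm_compr ?prj_inc ?tensm_id //.
  by rewrite prj_inc0 // tensm0.
under eq_bigr do rewrite -tensm_compr.
by rewrite -(linear_map_sum (tensm_linearr (idm W))) sum_inc tensm_id.
Qed.

(** A dual pair up to isomorphism: [U] stands for an object isomorphic to the unit, and the zigzags
    are only asked to be invertible. In this form the notion passes through a tensor functor. *)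
Definition weak_dual_pair U X Y (ev : hom (Y \ot X) U) (coev : hom U (X \ot Y)) :=
  is_iso ((idm X \otm ev) \o assoc X Y X \o (coev \otm idm X)) /\
  is_iso ((ev \otm idm Y) \o assoc_inv Y X Y \o (idm Y \otm coev)).

Lemma dual_pair_weak X Y (ev : hom (Y \ot X) (one C)) (coev : hom (one C) (X \ot Y)) :
  is_dual_pair ev coev -> weak_dual_pair ev coev.
Proof.
case=> zigzag1 zigzag2; split.
  by apply: (is_iso_cancell (runit_iso X)); rewrite !compA zigzag1; apply: lunit_iso.
by apply: (is_iso_cancell (lunit_iso Y)); rewrite !compA zigzag2; apply: runit_iso.
Qed.

Section WeakDual.
Context (U X Y : C) (ev : hom (Y \ot X) U) (coev : hom U (X \ot Y)).
Hypothesis U_one : isomorphic (one C) U.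
Hypothesis ev_coev : weak_dual_pair ev coev.

Lemma tensU_inj A B (f : hom A B) : idm U \otm f = 0 -> f = 0.
Proof.
move=> Uf0; have [u u_iso] := U_one.
have uf0 : idm (one C) \otm f = 0.
  apply: (iso_mono (is_iso_tensm u_iso (is_iso_id B))).
  by rewrite tensm_swap Uf0 comp0m compm0.
by apply: (iso_epi (lunit_iso A)); rewrite -lunit_nat uf0 comp0m compm0.
Qed.

Lemma tensU_iso A : isomorphic (U \ot A) A.
Proof.
have [u u_iso] := U_one.
apply: isomorphic_trans (_ : isomorphic (one C \ot A) A).
  apply: isomorphic_sym; exists (u \otm idm A).
  exact: is_iso_tensm u_iso (is_iso_id A).
by exists (lunit A); apply: lunit_iso.
Qed.

(** Transposing [f] and then transposing back returns [f], tensored with [U] and precomposed with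
    the second zigzag and an associator. As these are invertible, [f] is recovered from its
    transpose. *)
Lemma weak_dual_transpose A B (f : hom (Y \ot A) B) :
  (ev \otm idm B) \o assoc_inv Y X B
    \o (idm Y \otm ((idm X \otm f) \o assoc X Y A \o (coev \otm idm A)))
    \o assoc Y U A
  = (idm U \otm f) \o assoc U Y A
    \o (((ev \otm idm Y) \o assoc_inv Y X Y \o (idm Y \otm coev)) \otm idm A).
Proof.
rewrite !tensm_compr !tensm_compl -!compA.
rewrite -assoc_nat.
rewrite (comp_rewrite (assoc_inv_nat _ _ _)) tensm_id.
rewrite (comp_rewrite (tensm_swap _ _)).
congr (_ \o _).
rewrite [RHS](comp_rewrite (assoc_nat _ _ _)) tensm_id.
congr (_ \o _).
rewrite !compA; congr (_ \o _).
apply: (iso_epi (is_iso_tensm (assoc_iso Y X Y) (is_iso_id A))).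
rewrite -!compA -tensm_compl assocK tensm_id compm1.
have := pentagon Y X Y A; rewrite -!compA => ->.
by rewrite compA assocK comp1m.
Qed.

Lemma weak_dual_untranspose A B (g : hom A (X \ot B)) :
  (idm X \otm ((ev \otm idm B) \o assoc_inv Y X B \o (idm Y \otm g)))
    \o assoc X Y A \o (coev \otm idm A) \o (idm U \otm idm A)
  = assoc X U B
    \o (((idm X \otm ev) \o assoc X Y X \o (coev \otm idm X)) \otm idm B)
    \o assoc_inv U X B \o (idm U \otm g).
Proof.
rewrite tensm_id compm1 !tensm_compr !tensm_compl -!compA.
rewrite -(comp_rewrite (assoc_nat _ _ _)) tensm_id -tensm_swap.
rewrite [RHS](comp_rewrite (assoc_nat _ _ _)).
congr (_ \o _).
rewrite !compA; congr (_ \o _).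
rewrite -!compA.
rewrite -assoc_inv_nat tensm_id !compA; congr (_ \o _).
apply: (iso_mono (is_iso_tensm (is_iso_id X) (assoc_iso Y X B))).
rewrite !compA -tensm_compr assoc_invK tensm_id comp1m.
rewrite pentagon -!compA assoc_invK compm1.
by [].
Qed.

(** With zigzags that are merely invertible, the two transpositions are not claimed to be mutually
    inverse. Each is linear and injective by one of the identities above, and in finite dimension
    the two inequalities give the equality. *)
Lemma weak_dual_hdim A B : hdim (Y \ot A) B = hdim A (X \ot B).
Proof.
have [zigzag1 zigzag2] := ev_coev.
apply/eqP; rewrite eqn_leq; apply/andP; split.
  rewrite -(hdim_isol (X \ot B) (tensU_iso A)).
  apply: (dim_linear_inj (f := fun f : hom (Y \ot A) B =>
      (idm X \otm f) \o assoc X Y A \o (coev \otm idm A))) => [a f g|f f0].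
    by rewrite tensm_linearr !comp_linearl.
  apply: tensU_inj; apply: (iso_epi (assoc_iso U Y A)).
  apply: (iso_epi (is_iso_tensm zigzag2 (is_iso_id A))).
  by rewrite -weak_dual_transpose f0 tensm0 compm0 !comp0m.
rewrite -(hdim_isor (Y \ot A) (tensU_iso B)).
apply: (dim_linear_inj (f := fun g : hom A (X \ot B) =>
    (ev \otm idm B) \o assoc_inv Y X B \o (idm Y \otm g))) => [a f g|g g0].
  by rewrite tensm_linearr !comp_linearr.
apply: tensU_inj.
have inv_iso : is_iso (assoc_inv U X B : hom _ _).
  by exists (assoc U X B); rewrite assocK assoc_invK.
apply: (iso_mono inv_iso).
apply: (iso_mono (is_iso_tensm zigzag1 (is_iso_id B))).
apply: (iso_mono (assoc_iso X U B)).
rewrite !compA -weak_dual_untranspose g0 tensm0 !comp0m.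
by rewrite compm0.
Qed.

End WeakDual.
End Monoidal.

Section TensorFunctorDuals.
Context (k : fieldType) (C D : monCat k) (F : tensorFunctor C D).

Lemma is_iso_fmap (X Y : C) (f : hom X Y) : is_iso f -> is_iso (fmap F f).
Proof.
case=> g [gf fg]; exists (fmap F g).
by rewrite -!fmap_comp gf fg !fmap_id.
Qed.

Lemma tf2_natl (X X' Y : C) (f : hom X X') :
  tf2 F X' Y \o (fmap F f \otm idm (F Y)) = fmap F (f \otm idm Y) \o tf2 F X Y.
Proof. by rewrite -tf2_nat fmap_id. Qed.

Lemma tf2_natr (X Y Y' : C) (f : hom Y Y') :
  tf2 F X Y' \o (idm (F X) \otm fmap F f) = fmap F (idm X \otm f) \o tf2 F X Y.
Proof. by rewrite -tf2_nat fmap_id. Qed.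

(** Postcomposed with the invertible [tf2], a zigzag of the image pair becomes the image under [F]
    of the original zigzag, precomposed with another [tf2]. *)
Lemma tf_weak_dual (U X Y : C) (ev : hom (Y \ot X) U) (coev : hom U (X \ot Y))
    (tf2_inv : hom (F (X \ot Y)) (F X \ot F Y)) :
  tf2 F X Y \o tf2_inv = idm _ ->
  weak_dual_pair ev coev ->
  weak_dual_pair (fmap F ev \o tf2 F Y X) (tf2_inv \o fmap F coev).
Proof.
move=> tf2K [zigzag1 zigzag2]; split.
  apply: (is_iso_cancell (tf2_iso F X U)).
  suff -> : tf2 F X U \o ((idm (F X) \otm (fmap F ev \o tf2 F Y X))
      \o assoc (F X) (F Y) (F X) \o ((tf2_inv \o fmap F coev) \otm idm (F X)))
    = fmap F ((idm X \otm ev) \o assoc X Y X \o (coev \otm idm X)) \o tf2 F U X.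
    by apply: is_iso_comp (tf2_iso _ _ _); apply: is_iso_fmap.
  rewrite tensm_compr tensm_compl -!compA (comp_rewrite (tf2_natr _ _)).
  rewrite !fmap_comp -!compA -tf2_natl; congr (_ \o _).
  rewrite !compA; congr (_ \o _).
  rewrite -tf2_assoc -!compA -tensm_compl tf2K tensm_id compm1.
  by [].
apply: (is_iso_cancell (tf2_iso F U Y)).
suff -> : tf2 F U Y \o (((fmap F ev \o tf2 F Y X) \otm idm (F Y))
    \o assoc_inv (F Y) (F X) (F Y) \o (idm (F Y) \otm (tf2_inv \o fmap F coev)))
  = fmap F ((ev \otm idm Y) \o assoc_inv Y X Y \o (idm Y \otm coev)) \o tf2 F Y U.
  by apply: is_iso_comp (tf2_iso _ _ _); apply: is_iso_fmap.
rewrite tensm_compr tensm_compl -!compA (comp_rewrite (tf2_natl _ _)).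
rewrite !fmap_comp -!compA -tf2_natr; congr (_ \o _).
rewrite !compA; congr (_ \o _).
apply: (iso_mono (is_iso_fmap (assoc_iso Y X Y))).
rewrite !compA tf2_assoc -fmap_comp assoc_invK fmap_id comp1m.
rewrite -!compA (comp_cancel (assoc_invK _ _ _)) -tensm_compr tf2K tensm_id.
by rewrite compm1.
Qed.

End TensorFunctorDuals.

(** * Fusion and branching rules *)

Section FusionRules.
Context (k : fieldType) (C : fusionCat k).
Implicit Types (V W A B S : C) (X Y Z T : Irr C).

Definition fusion X Y Z : nat := mult Z (irr X \ot irr Y).

Definition one_irr : Irr C := projT1 (cid (irr_surj (one_simple C))).

Lemma one_irrP : isomorphic (one C) (irr one_irr).
Proof. by rewrite /one_irr; case: cid. Qed.

(** Taken from the second half of rigidity, so that tensoring with [irr X] on the left is left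
    adjoint to tensoring with [codual X]. It is used only through the multiplicities of simple
    objects in it. *)
Definition codual X : C := projT1 (cid (fus_rigid (irr X)).2).

Lemma codualP X : is_left_dual (codual X) (irr X).
Proof. by rewrite /codual; case: cid. Qed.

Lemma mult_iso X V W : isomorphic V W -> mult X V = mult X W.
Proof. exact: hdim_isor. Qed.

Lemma mult_tensl Z V Y :
  mult Z (V \ot irr Y) = (\sum_X mult X V * fusion X Y Z)%N.
Proof.
have h_add : additive_dim (fun U : C => mult Z (U \ot irr Y)).
  by move=> n S U /(direct_sum_tensl (irr Y)); apply: hdim_direct_sumr.
exact: additive_dimE V h_add.
Qed.

Lemma mult_tensr Z X W :
  mult Z (irr X \ot W) = (\sum_Y mult Y W * fusion X Y Z)%N.
Proof.
have h_add : additive_dim (fun U : C => mult Z (irr X \ot U)).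
  by move=> n S U /(direct_sum_tensr (irr X)); apply: hdim_direct_sumr.
exact: additive_dimE W h_add.
Qed.

Lemma mult_tens Z V W :
  mult Z (V \ot W) = (\sum_X \sum_Y mult X V * mult Y W * fusion X Y Z)%N.
Proof.
have h_add : additive_dim (fun U : C => mult Z (U \ot W)).
  by move=> n S U /(direct_sum_tensl W); apply: hdim_direct_sumr.
rewrite (additive_dimE V h_add); apply: eq_bigr => X _.
by rewrite mult_tensr big_distrr; apply: eq_bigr => Y _ /=; rewrite mulnA.
Qed.

Lemma fusion_assoc X Y Z T :
  (\sum_W fusion X Y W * fusion W Z T = \sum_W fusion Y Z W * fusion X W T)%N.
Proof.
rewrite -mult_tensl -mult_tensr; apply: mult_iso.
by exists (assoc (irr X) (irr Y) (irr Z)); apply: assoc_iso.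
Qed.

Lemma fusion_unitl X Y : fusion one_irr X Y = (Y == X).
Proof.
rewrite -mult_irr; apply: mult_iso.
apply: isomorphic_trans (_ : isomorphic (one C \ot irr X) (irr X)).
  case: one_irrP => f f_iso; apply: isomorphic_sym; exists (f \otm idm _).
  exact: is_iso_tensm f_iso (is_iso_id _).
by exists (lunit (irr X)); apply: lunit_iso.
Qed.

Lemma fusion_unitr X Y : fusion X one_irr Y = (Y == X).
Proof.
rewrite -mult_irr; apply: mult_iso.
apply: isomorphic_trans (_ : isomorphic (irr X \ot one C) (irr X)).
  case: one_irrP => f f_iso; apply: isomorphic_sym; exists (idm _ \otm f).
  exact: is_iso_tensm (is_iso_id _) f_iso.
by exists (runit (irr X)); apply: runit_iso.
Qed.

Lemma fusion_dual X Y Z :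
  fusion X Y Z = (\sum_W mult W (codual X) * fusion W Z Y)%N.
Proof.
have [ev [coev /dual_pair_weak ev_coev]] := codualP X.
have one_one : isomorphic (one C) (one C).
  by exists (idm _); apply: is_iso_id.
rewrite -mult_tensl /fusion /mult hdimC.
exact: (weak_dual_hdim one_one ev_coev).
Qed.

End FusionRules.

Section BranchingRules.
Context (k : fieldType) (C D : fusionCat k) (F : tensorFunctor C D).
Implicit Types (X Y Z T : Irr C) (a b c : Irr D).

Definition branching X a : nat := mult a (F (irr X)).

Lemma fmap_linear0 (V W : C) : fmap F (0 : hom V W) = 0.
Proof. exact: linear_map0 (@fmap_linear _ _ _ F V W). Qed.

Lemma direct_sum_fobj (I : finType) (S : I -> C) (V : C) :
  is_direct_sum S V -> is_direct_sum (fun i => F (S i)) (F V).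
Proof.
case=> inc [prj [prj_inc prj_inc0 sum_inc]].
exists (fun i => fmap F (inc i)), (fun i => fmap F (prj i)).
split=> [i|i j ij|]; rewrite -?fmap_comp ?prj_inc ?fmap_id //.
  by rewrite prj_inc0 // fmap_linear0.
under eq_bigr do rewrite -fmap_comp.
by rewrite -(linear_map_sum (@fmap_linear _ _ _ F V V)) sum_inc fmap_id.
Qed.

Lemma mult_fobj a (V : C) :
  mult a (F V) = (\sum_X mult X V * branching X a)%N.
Proof.
have h_add : additive_dim (fun U : C => mult a (F U)).
  by move=> n S U /direct_sum_fobj; apply: hdim_direct_sumr.
exact: additive_dimE V h_add.
Qed.

Lemma branching_tens X Y c :
  (\sum_Z fusion X Y Z * branching Z c =
   \sum_a \sum_b branching X a * branching Y b * fusion a b c)%N.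
Proof.
rewrite -mult_fobj -mult_tens; symmetry; apply: mult_iso.
by exists (tf2 F (irr X) (irr Y)); apply: tf2_iso.
Qed.

Lemma fobj_one : isomorphic (one D) (F (one C)).
Proof. by exists (tf0 F); apply: tf0_iso. Qed.

Lemma branching_one a : branching (one_irr C) a = (a == one_irr D).
Proof.
rewrite -mult_irr; apply: mult_iso.
apply: isomorphic_trans (one_irrP D).
apply: isomorphic_trans (isomorphic_sym fobj_one).
case: (one_irrP C) => f f_iso; apply: isomorphic_sym; exists (fmap F f).
exact: is_iso_fmap.
Qed.

(** Reciprocity for the image pair: the multiplicity of [c] in F(X) is dim Hom(F(X) \ot 1, c), which
    equals dim Hom(1, F(codual X) \ot c). *)
Lemma branching_dual X c :
  branching X c =
  (\sum_Y mult Y (codual X) * \sum_a branching Y a * fusion a c (one_irr D))%N.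
Proof.
have [ev [coev /dual_pair_weak ev_coev]] := codualP X.
have [tf2_inv [_ tf2K]] := tf2_iso F (codual X) (irr X).
have := weak_dual_hdim fobj_one (tf_weak_dual tf2K ev_coev)
  (one D) (irr c).
rewrite (hdim_isol _ (_ : isomorphic (F (irr X) \ot one D) (F (irr X)))); last first.
  by exists (runit (F (irr X))); apply: runit_iso.
rewrite hdimC -/(mult _ _) -/(branching X c) => ->.
rewrite (hdim_isol _ (one_irrP D)) -/(mult _ _) mult_tensl.
under eq_bigr do rewrite mult_fobj big_distrl /=.
rewrite exchange_big /=; apply: eq_bigr => Y _; rewrite big_distrr /=.
by apply: eq_bigr => a _; rewrite mulnA.
Qed.

(** The adjunction only provides bijections of sets. Naturality in the second variable writes [phi]
    at [h] as [fmap G h] composed with the adjunction unit, hence [phi] is linear and preserves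
    dimensions. *)
Lemma right_adjoint_mult (G : linFunctor D C) X a :
  is_right_adjoint F G -> mult X (G (irr a)) = branching X a.
Proof.
case=> phi [phi_bij phi_natl phi_natr].
have phiE (V : D) (h : hom (F (irr X)) V) :
    phi (irr X) V h = fmap G h \o phi (irr X) (F (irr X)) (idm _).
  by rewrite -phi_natr compm1.
have phi_lin : linear (phi (irr X) (irr a)).
  by move=> s u v; rewrite phiE fmap_linear comp_linearl -!phiE.
rewrite /branching /mult [RHS]hdimC.
have [psi phiK psiK] := phi_bij (irr X) (irr a).
apply: (dim_linear_can (f := psi) (g := phi (irr X) (irr a))) => //.
by move=> s u v; apply: (can_inj phiK); rewrite psiK phi_lin !psiK.
Qed.

Lemma mem_up1 X a : (a \in up1 F X) = (branching X a != 0%N).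
Proof.
by rewrite inE -lt0n; apply/asboolP/idP => /irr_factorP.
Qed.

Lemma mem_down1 X a : (X \in down1 F a) = (branching X a != 0%N).
Proof.
by rewrite inE -lt0n; apply/asboolP/idP => /irr_factorP.
Qed.

Lemma normal_branching X a :
  normal F -> branching X (one_irr D) != 0%N -> a != one_irr D ->
  branching X a = 0%N.
Proof.
move=> F_normal X1 a1.
have : is_factor (one D) (F (irr X)).
  apply/(simple_factorP _ (one_simple D)).
  by rewrite (hdim_isol _ (one_irrP D)) lt0n.
move=> /F_normal[n FX_sum].
rewrite /branching /mult (hdim_direct_sumr _ FX_sum) big1 // => _ _.
by rewrite (hdim_isor _ (one_irrP D)) -/(mult _ _) mult_irr (negPf a1).
Qed.

Lemma dominantP :
  dominant F <-> forall a, exists X, branching X a != 0%N.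
Proof.
split=> F_dom a; have [X Xa] := F_dom a; exists X.
  by rewrite -lt0n; apply/irr_factorP.
by apply/irr_factorP; rewrite lt0n.
Qed.

End BranchingRules.

(** * Perron-Frobenius theory *)

Section PositiveMatrix.
Context (R : realType) (I : finType).
Implicit Types (S P : I -> I -> R) (u v w : I -> R).

Definition dotp u v : R := \sum_i u i * v i.

Definition mapp P v : I -> R := fun i => \sum_j P i j * v j.

(** Take for [c] the least ratio [v i / w i]. Then [v - c * w] is nonnegative and vanishes at the
    minimizing index, so its image under [P] vanishes there too, and positivity of [P] forces it to
    be zero. *)
Lemma positive_eigen_unique P w v (lambda : R) :
  (forall i j, 0 < P i j) -> (forall i, 0 < w i) ->
  (forall i, mapp P w i = lambda * w i) ->
  (forall i, mapp P v i = lambda * v i) ->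
  exists c, forall i, v i = c * w i.
Proof.
move=> P_gt0 w_gt0 Pw Pv.
have [i0|noI] := pickP (fun _ : I => true); last by exists 0 => i; have := noI i.
move=> _; pose m := [arg min_(i < i0) (v i / w i)]%O.
have m_min i : v m / w m <= v i / w i.
  by rewrite /m; case: arg_minP => // j _; apply.
exists (v m / w m) => i; set c := v m / w m.
pose u i := v i - c * w i.
have u_ge0 j : 0 <= u j by rewrite subr_ge0 -ler_pdivlMr.
have um0 : u m = 0 by rewrite /u /c divfK ?subrr // gt_eqF.
have Pu : mapp P u m = 0.
  transitivity (mapp P v m - c * mapp P w m).
    rewrite /mapp mulr_sumr -sumrB; apply: eq_bigr => j _.
    by rewrite /u; ring.
  by rewrite Pw Pv mulrCA -mulrBr -/(u m) um0 mulr0.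
have : u i = 0.
  have := psumr_eq0P (fun j _ => mulr_ge0 (ltW (P_gt0 m j)) (u_ge0 j)) Pu.
  by move=> /(_ i isT)/eqP; rewrite mulf_eq0 gt_eqF //= => /eqP.
by move/eqP; rewrite subr_eq0 => /eqP.
Qed.

(** The quadratic form attains its maximum on the unit sphere, compact as a closed part of a cube,
    and scaling extends the bound to all vectors. Functions on [I] are copied to row vectors, which
    carry the topology. *)
Lemma rayleigh_max S (i0 : I) :
  exists (lambda : R) w, dotp w w = 1 /\ dotp w (mapp S w) = lambda /\
    forall v, dotp v (mapp S v) <= lambda * dotp v v.
Proof.
pose n := #|I|.
pose toI (x : 'rV[R]_n) : I -> R := fun i => x ord0 (enum_rank i).
pose q (x : 'rV[R]_n) := dotp (toI x) (mapp S (toI x)).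
pose nrm (x : 'rV[R]_n) := dotp (toI x) (toI x).
pose ofI v : 'rV[R]_n := \row_j v (enum_val j).
have ofIK v i : toI (ofI v) i = v i by rewrite /toI mxE enum_rankK.
have coordc i : continuous (fun x => toI x i) by exact: coord_continuous.
have sumc (f : I -> 'rV[R]_n -> R) :
    (forall i, continuous (f i)) -> continuous (fun x => \sum_i f i x).
  by move=> fc; apply: continuous_big => [|i _]; [exact: add_continuous|exact: fc].
have mulc (f g : 'rV[R]_n -> R) :
    continuous f -> continuous g -> continuous (fun x => f x * g x).
  by move=> fc gc x; apply: (continuousM (fc x) (gc x)).
have nrmc : continuous nrm by apply: sumc => i; apply: mulc.
have qc : continuous q.
  apply: (sumc) => i; apply: (mulc) => //; apply: (sumc) => j; apply: (mulc) => //.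
  exact: cst_continuous.
pose K := ([set x | nrm x = 1])%classic.
have Kcube : (K `<=` [set x : 'rV[R]_n | forall i, `[(-1 : R), 1]%classic (x ord0 i)])%classic.
  move=> x /= x1 i; rewrite in_itv /= -ler_norml -(ler_pXn2r (n := 2)) ?nnegrE //.
  rewrite real_normK ?num_real // expr1n -x1 /nrm /dotp (bigD1 (enum_val i)) //=.
  rewrite /toI enum_valK -expr2 lerDl sumr_ge0 // => j _.
  by rewrite -expr2 sqr_ge0.
have Kclosed : closed K.
  have -> : K = (nrm @^-1` [set 1%R])%classic by [].
  by apply: preimage_closed => [x _|]; [exact: nrmc|exact: closed_eq].
have Kcompact : compact K.
  apply: (subclosed_compact Kclosed _ Kcube).
  by apply: (@rV_compact R n (fun=> `[(-1 : R), 1]%classic)) => i; apply: segment_compact.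
have K0 : (K !=set0)%classic.
  exists (ofI (fun i => (i == i0)%:R)); rewrite /K /= /nrm /dotp.
  rewrite (bigD1 i0) //= !ofIK eqxx mulr1 big1 ?addr0 // => i /negPf ne.
  by rewrite !ofIK ne mulr0.
have [|x xK xmax] := compact_EVT_max K0 Kcompact (f := q).
  by apply: continuous_subspaceT.
exists (q x), (toI x); split; first exact: set_mem xK.
split=> // v; set s := dotp v v.
have s_ge0 : 0 <= s by apply: sumr_ge0 => i _; rewrite -expr2 sqr_ge0.
have [s0|s_neq0] := eqVneq s 0.
  have v0 i : v i = 0.
    have := psumr_eq0P (fun i _ => sqr_ge0 (v i)) (_ : \sum_i v i ^+ 2 = 0).
    move=> /(_ s0 i isT) /eqP; by rewrite sqrf_eq0 => /eqP.
  by rewrite s0 mulr0 /dotp big1 // => i _; rewrite v0 mul0r.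
have s_gt0 : 0 < s by rewrite lt_def s_neq0.
pose r := Num.sqrt s.
have r2 : r ^+ 2 = s by rewrite sqr_sqrtr.
have r0 : r != 0 by rewrite gt_eqF // sqrtr_gt0.
pose y := ofI (fun i => v i / r).
have yK : y \in K.
  apply: mem_set; rewrite /K /= /nrm /dotp; under eq_bigr do rewrite !ofIK mulf_div.
  by rewrite -mulr_suml -/(dotp v v) -/s -[r * r]expr2 r2 divff.
have := xmax _ yK; rewrite (_ : q y = dotp v (mapp S v) / s); last first.
  rewrite /q /dotp mulr_suml; apply: eq_bigr => i _; rewrite ofIK /mapp.
  rewrite -!mulrA; congr (_ * _); rewrite mulr_sumr mulr_suml.
  by apply: eq_bigr => j _; rewrite ofIK -r2; field.
by rewrite ler_pdivrMr.
Qed.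

Lemma dotpC u v : dotp u v = dotp v u.
Proof. by apply: eq_bigr => i _; rewrite mulrC. Qed.

Lemma dotp_linearr w u v (t : R) :
  dotp w (fun i => u i + t * v i) = dotp w u + t * dotp w v.
Proof.
by rewrite /dotp mulr_sumr -big_split; apply: eq_bigr => i _ /=; ring.
Qed.

Lemma dotp_linearl w u v (t : R) :
  dotp (fun i => u i + t * v i) w = dotp u w + t * dotp v w.
Proof. by rewrite dotpC dotp_linearr !(dotpC w). Qed.

Lemma mapp_linear P u v (t : R) i :
  mapp P (fun i => u i + t * v i) i = mapp P u i + t * mapp P v i.
Proof. exact: dotp_linearr. Qed.

Lemma dotp_self_eq0 v : dotp v v = 0 -> forall i, v i = 0.
Proof.
move=> v0 i; have := psumr_eq0P (fun i _ => sqr_ge0 (v i)) v0.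
by move=> /(_ i isT) /eqP; rewrite sqrf_eq0 => /eqP.
Qed.

Lemma perron_symmetric S (i0 : I) :
  (forall i j, S i j = S j i) -> (forall i j, 0 < S i j) ->
  exists (lambda : R) w,
    (forall i, 0 < w i) /\ (forall i, mapp S w i = lambda * w i).
Proof.
move=> S_sym S_gt0; have [lambda [w [w1 [wSw S_le]]]] := rayleigh_max S i0.
(* Since [S] has positive entries, passing to absolute values keeps the norm and cannot lower the
   form, so [u] is again a maximizer. *)
pose u i := `|w i|; exists lambda, u.
have uu : dotp u u = 1.
  by rewrite -w1; apply: eq_bigr => i _; rewrite -expr2 real_normK ?num_real.
have uSu : dotp u (mapp S u) = lambda.
  apply/eqP; rewrite eq_le; have := S_le u; rewrite uu mulr1 => -> /=.
  rewrite -wSw; apply: ler_sum => i _; rewrite /mapp !mulr_sumr.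
  apply: ler_sum => j _; apply: le_trans (ler_norm _) _.
  by rewrite !normrM (gtr0_norm (S_gt0 i j)).
have SC v v' : dotp v (mapp S v') = dotp v' (mapp S v).
  rewrite /dotp /mapp; under eq_bigr do rewrite mulr_sumr.
  rewrite exchange_big; apply: eq_bigr => i _; rewrite mulr_sumr.
  by apply: eq_bigr => j _; rewrite (S_sym i j); ring.
pose r i := lambda * u i - mapp S u i.
pose a := dotp r r; pose q := lambda * a - dotp r (mapp S r).
have ra : lambda * dotp r u - dotp r (mapp S u) = a.
  rewrite /a /dotp mulr_sumr -sumrB; apply: eq_bigr => i _.
  by rewrite /r; ring.
have q_ge0 : 0 <= q by rewrite subr_ge0.
(* The quadratic form lambda |v|^2 - <v, S v> is nonnegative and vanishes at u,
   so its gradient, which is proportional to r, vanishes at u. *)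
have a0 : a = 0.
  have a_ge0 : 0 <= a by apply: sumr_ge0 => i _; rewrite -expr2 sqr_ge0.
  apply/eqP; rewrite eq_le a_ge0 andbT leNgt; apply/negP => a_gt0.
  (* At [u + t * r] the quadratic form lambda |v|^2 - <v, S v> is [2 * t * a + t ^+ 2 * q]. This [t]
     makes it - a^2 (2 + q) / (1 + q)^2 < 0; the denominator [1 + q] is used because [q] may be
     zero. *)
  pose t := - (a / (1 + q)).
  have := S_le (fun i => u i + t * r i); apply/negP; rewrite -ltNge.
  have -> : dotp (fun i => u i + t * r i) (mapp S (fun i => u i + t * r i)) =
      lambda + 2 * t * dotp r (mapp S u) + t ^+ 2 * dotp r (mapp S r).
    transitivity (dotp (fun i => u i + t * r i) (fun i => mapp S u i + t * mapp S r i)).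
      by apply: eq_bigr => i _; rewrite mapp_linear.
    by rewrite dotp_linearr !dotp_linearl uSu (SC u r); ring.
  rewrite dotp_linearr !dotp_linearl uu (dotpC u r) -/a.
  rewrite -subr_gt0 (_ : _ - _ =
    - (2 * t * (lambda * dotp r u - dotp r (mapp S u)) + t ^+ 2 * q)); last first.
    by rewrite /q; ring.
  rewrite ra (_ : - _ = a ^+ 2 * (2 + q) / (1 + q) ^+ 2); last first.
    by rewrite /t; field; apply: lt0r_neq0; rewrite ltr_wpDr.
  by rewrite divr_gt0 ?mulr_gt0 ?exprn_gt0 // ?ltr_wpDr.
have Su i : mapp S u i = lambda * u i.
  by apply/esym/eqP; rewrite -subr_eq0; apply/eqP/(dotp_self_eq0 a0).
split=> // i; rewrite lt_def normr_ge0 andbT.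
(* A zero entry of [u] gives a zero entry of [S u]; as [S] is positive, all of [u] would vanish,
   against its norm being one. *)
apply: contra_neq (oner_neq0 R) => ui0; rewrite -uu.
apply: big1 => j _.
have : mapp S u i = 0 by rewrite Su /u (_ : `|w i| = 0) ?mulr0 // ui0 normr0.
move/(psumr_eq0P (fun j _ => mulr_ge0 (ltW (S_gt0 i j)) (normr_ge0 (w j)))).
move=> /(_ j isT)/eqP; rewrite mulf_eq0 gt_eqF //= => /eqP uj0.
by rewrite /u uj0 mulr0.
Qed.

End PositiveMatrix.

(** * Based rings *)

Lemma mapp_comp (R : realType) (I : finType) (P Q : I -> I -> R) v i :
  mapp (fun i j => \sum_l P i l * Q l j) v i = mapp P (mapp Q v) i.
Proof.
rewrite /mapp; under eq_bigr do rewrite mulr_suml.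
rewrite exchange_big; apply: eq_bigr => j _; rewrite mulr_sumr.
by apply: eq_bigr => l _; rewrite mulrA.
Qed.

Lemma eq_mapp (R : realType) (I : finType) (P : I -> I -> R) u v i :
  u =1 v -> mapp P u i = mapp P v i.
Proof. by move=> uv; apply: eq_bigr => j _; rewrite uv. Qed.

(* [N x y z] is the multiplicity of [z] in the product [x * y]; the last axiom is Frobenius
   reciprocity, [dl x] being the decomposition of a dual of [x]. *)
Record based_ring (R : realType) (I : finType) (N : I -> I -> I -> R) (e : I)
    (dl : I -> I -> R) : Prop := BasedRing {
  br_ge0 : forall x y z, 0 <= N x y z;
  br_dual_ge0 : forall x y, 0 <= dl x y;
  br_assoc : forall x y z t,
    \sum_w N x y w * N w z t = \sum_w N y z w * N x w t;
  br_unitl : forall x y, N e x y = (y == x)%:R;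
  br_unitr : forall x y, N x e y = (y == x)%:R;
  br_dual : forall x y z, N x y z = \sum_w dl x w * N w z y
}.

Section BasedRing.
Context (R : realType) (I : finType) (N : I -> I -> I -> R) (e : I)
  (dl : I -> I -> R) (brN : based_ring N e dl).
Implicit Types (u v d : I -> R).

Lemma dual_mul_unit x : \sum_w dl x w * N w x e = 1.
Proof. by rewrite -(br_dual brN) (br_unitr brN) eqxx. Qed.

(** If the unit occurs in w y, then z occurs in z (w y) = (z w) y, hence in x y for some x. By
    [dual_mul_unit], such a w exists among the constituents of the dual of y. *)
Lemma left_mul_gt0 y z : 0 < \sum_x N x y z.
Proof.
rewrite lt_def sumr_ge0 ?andbT => [|x _]; last exact: br_ge0 brN _ _ _.
apply/eqP => sN0.
have N0 x : N x y z = 0.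
  by apply: (psumr_eq0P _ sN0) => // w _; apply: br_ge0 brN _ _ _.
have := oner_neq0 R; rewrite -(dual_mul_unit y) => /eqP; apply.
apply: big1 => w _; rewrite (_ : N w y e = 0) ?mulr0 //.
apply/eqP; rewrite eq_le (br_ge0 brN) andbT.
have : \sum_t N w y t * N z t z = 0.
  by rewrite -(br_assoc brN) big1 // => t _; rewrite N0 mulr0.
rewrite (bigD1 e) //= (br_unitr brN) eqxx mulr1 => <-.
by rewrite lerDl sumr_ge0 // => t _; rewrite mulr_ge0 ?(br_ge0 brN).
Qed.

(** As a matrix for [mapp], [lmul c] is left multiplication by the element with coordinates [c],
    while [rmul t v] is the product v t. Thus [lmul_rmul] is associativity. *)
Definition lmul (c : I -> R) z y := \sum_x c x * N x y z.

Definition rmul (t : I) v z := \sum_y v y * N y t z.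

Lemma lmul_rmul (c : I -> R) t v z :
  mapp (lmul c) (rmul t v) z = rmul t (mapp (lmul c) v) z.
Proof.
have -> : mapp (lmul c) (rmul t v) z =
    \sum_x \sum_u c x * v u * \sum_y N u t y * N x y z.
  transitivity (\sum_y \sum_x \sum_u c x * v u * (N u t y * N x y z)).
    apply: eq_bigr => y _; rewrite /lmul mulr_suml; apply: eq_bigr => x _.
    by rewrite mulr_sumr; apply: eq_bigr => u _; ring.
  rewrite exchange_big; apply: eq_bigr => x _ /=; rewrite exchange_big.
  by apply: eq_bigr => u _; rewrite mulr_sumr.
rewrite /rmul.
transitivity (\sum_y \sum_x \sum_u c x * v u * (N x u y * N y t z)).
  rewrite [RHS]exchange_big; apply: eq_bigr => x _ /=; rewrite [RHS]exchange_big.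
  by apply: eq_bigr => u _ /=; rewrite -(br_assoc brN) mulr_sumr.
apply: eq_bigr => y _; rewrite exchange_big /mapp mulr_suml.
apply: eq_bigr => u _ /=; rewrite /lmul !mulr_suml; apply: eq_bigr => x _.
by ring.
Qed.

Definition positive_character d : Prop :=
  (forall x, 0 < d x) /\ forall x y, \sum_z N x y z * d z = d x * d y.

(* Right multiplications commute with S = L^T L, where L is left multiplication by the sum of
   the basis; the Perron eigenvector of S is therefore a common eigenvector of all of them. *)
Lemma positive_character_exists : exists d, positive_character d.
Proof.
(* By Frobenius reciprocity [L'] is the transpose of [L]. So [S] is symmetric with positive entries
   and, as a composite of two left multiplications, still commutes with right multiplications. *)
pose L := lmul (fun=> 1); pose L' := lmul (fun y => \sum_x dl x y).
have LE y z : L z y = \sum_x N x y z by apply: eq_bigr => x _; rewrite mul1r.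
have L'E y z : L' y z = L z y.
  rewrite LE; under [RHS]eq_bigr do rewrite (br_dual brN).
  by rewrite exchange_big; apply: eq_bigr => x _; rewrite mulr_suml.
pose S i j := \sum_l L' i l * L l j.
have SE i j : S i j = \sum_l L l i * L l j.
  by apply: eq_bigr => l _; rewrite L'E.
have L_gt0 i j : 0 < L i j by rewrite LE left_mul_gt0.
have S_sym i j : S i j = S j i.
  by rewrite !SE; apply: eq_bigr => l _; rewrite mulrC.
have S_gt0 i j : 0 < S i j.
  rewrite SE (bigD1 e) //= ltr_pwDl ?mulr_gt0 // sumr_ge0 // => l _.
  by rewrite mulr_ge0 // ltW.
have [lambda [w [w_gt0 Sw]]] := perron_symmetric e S_sym S_gt0.
have S_rmul t i : mapp S (rmul t w) i = lambda * rmul t w i.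
  rewrite mapp_comp (eq_mapp _ _ (lmul_rmul _ t w)) lmul_rmul.
  rewrite /rmul mulr_sumr; apply: eq_bigr => y _.
  by rewrite -mapp_comp Sw mulrA.
have /(_ _)/cid-/all_sig[d dE] : forall t, exists c, forall i, rmul t w i = c * w i.
  by move=> t; apply: positive_eigen_unique S_gt0 w_gt0 Sw (S_rmul t).
have rmul_ge0 t i : 0 <= rmul t w i.
  by apply: sumr_ge0 => y _; rewrite mulr_ge0 ?(br_ge0 brN) // ltW.
exists d; split=> [t|x y].
  have : 0 <= d t by rewrite -(pmulr_lge0 _ (w_gt0 e)) -dE.
  rewrite lt_def => ->; rewrite andbT; apply/eqP => dt0.
  have /psumr_eq0P N0 : rmul t w e = 0 by rewrite dE dt0 mul0r.
  have := left_mul_gt0 t e; rewrite big1 ?ltxx // => z _.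
  have /eqP := N0 (fun y _ => mulr_ge0 (ltW (w_gt0 y)) (br_ge0 brN _ _ _)) z isT.
  by rewrite mulf_eq0 gt_eqF //= => /eqP.
(* After multiplication by [w e], the two sides are the coefficients at [e] of w (x y) and of (w x)
   y. *)
apply: (mulIf (lt0r_neq0 (w_gt0 e))); rewrite -mulrA -dE mulr_suml.
transitivity (\sum_t \sum_z w t * (N x y z * N t z e)).
  rewrite exchange_big; apply: eq_bigr => z _ /=.
  by rewrite -mulrA -dE /rmul mulr_sumr; apply: eq_bigr => t _; ring.
under eq_bigr do rewrite -mulr_sumr -(br_assoc brN) mulr_sumr.
rewrite exchange_big /rmul mulr_sumr; apply: eq_bigr => t _ /=.
under eq_bigr do rewrite mulrA.
by rewrite -mulr_suml -/(rmul x w t) dE mulrA.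
Qed.

Section PositiveCharacter.
Variable d : I -> R.
Hypothesis d_char : positive_character d.

Lemma character_gt0 x : 0 < d x.
Proof. by case: d_char. Qed.

Lemma characterE x y : \sum_z N x y z * d z = d x * d y.
Proof. by case: d_char. Qed.

Lemma character_unit : d e = 1.
Proof.
have := characterE e e; rewrite (bigD1 e) //= (br_unitl brN) eqxx mul1r.
rewrite big1 ?addr0 => [de|z /negPf ze].
  by apply: (mulfI (lt0r_neq0 (character_gt0 e))); rewrite -de mulr1.
by rewrite (br_unitl brN) ze mul0r.
Qed.

Lemma character_sqr_gt0 : 0 < \sum_x d x ^+ 2.
Proof.
rewrite (bigD1 e) //= ltr_pwDl ?exprn_gt0 ?character_gt0 //.
by apply: sumr_ge0 => x _; apply: sqr_ge0.
Qed.

(** Pair the inequality with [d], a positive left eigenvector. An inequality is assumed because the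
    absolute values of a complex eigenvector satisfy nothing stronger. *)
Lemma character_eigen_le x (a : R) u :
  (forall y, 0 <= u y) -> (exists y, u y != 0) ->
  (forall z, a * u z <= \sum_y N x y z * u y) -> a <= d x.
Proof.
move=> u_ge0 [y0 uy0] au.
have du_gt0 : 0 < \sum_z d z * u z.
  rewrite (bigD1 y0) //= ltr_pwDl ?mulr_gt0 ?character_gt0 //.
    by rewrite lt_def uy0 u_ge0.
  by rewrite sumr_ge0 // => y _; rewrite mulr_ge0 // ltW ?character_gt0.
rewrite -(ler_pM2r du_gt0).
have -> : d x * (\sum_z d z * u z) = \sum_z d z * \sum_y N x y z * u y.
  transitivity (\sum_y \sum_z N x y z * d z * u y).
    rewrite mulr_sumr; apply: eq_bigr => y _.
    by rewrite -mulr_suml characterE mulrA.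
  rewrite exchange_big; apply: eq_bigr => z _; rewrite mulr_sumr.
  by apply: eq_bigr => y _; ring.
rewrite mulr_sumr; apply: ler_sum => z _.
by rewrite mulrCA ler_pM2l ?character_gt0.
Qed.

(* By Frobenius reciprocity the positive left eigenvector [d] of left multiplication by [x] is
   also a right eigenvector, and pairing the two shows that the eigenvalues agree. *)
Lemma character_eigen x z : \sum_y N x y z * d y = d x * d z.
Proof.
pose dd := \sum_w dl x w * d w.
have eigen t : \sum_y N x y t * d y = dd * d t.
  under eq_bigr do rewrite (br_dual brN) mulr_suml.
  rewrite exchange_big /dd mulr_suml; apply: eq_bigr => w _ /=.
  by under eq_bigr do rewrite -mulrA; rewrite -mulr_sumr characterE mulrA.
rewrite eigen; congr (_ * _).
apply: (mulIf (lt0r_neq0 character_sqr_gt0)); rewrite !mulr_sumr.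
transitivity (\sum_t d t * \sum_y N x y t * d y).
  by apply: eq_bigr => t _; rewrite eigen; ring.
transitivity (\sum_y \sum_t N x y t * d t * d y).
  rewrite exchange_big; apply: eq_bigr => t _; rewrite mulr_sumr.
  by apply: eq_bigr => y _; ring.
by apply: eq_bigr => y _; rewrite -mulr_suml characterE; ring.
Qed.

End PositiveCharacter.

Lemma positive_character_unique d d' :
  positive_character d -> positive_character d' -> d =1 d'.
Proof.
have le d1 d2 x : positive_character d1 -> positive_character d2 -> d1 x <= d2 x.
  move=> d1_char d2_char; apply: (character_eigen_le d2_char (u := d1)).
  - by move=> y; apply: ltW; apply: character_gt0.
  - by exists e; apply: lt0r_neq0; apply: character_gt0.
  - by move=> z; rewrite character_eigen.
by move=> d_char d'_char x; apply/eqP; rewrite eq_le !le.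
Qed.

End BasedRing.

(** [bm_dual] expresses compatibility with duality: the multiplicity of [c] in the image of [x] is
    that of the unit in the product of the image of the dual of [x] with [c]. *)
Record based_morphism (R : realType) (I J : finType)
    (N : I -> I -> I -> R) (e : I) (dl : I -> I -> R)
    (N' : J -> J -> J -> R) (e' : J) (f : I -> J -> R) : Prop := BasedMorphism {
  bm_ge0 : forall x a, 0 <= f x a;
  bm_mul : forall x y c, \sum_z N x y z * f z c =
    \sum_a \sum_b f x a * f y b * N' a b c;
  bm_one : forall a, f e a = (a == e')%:R;
  bm_dual : forall x c,
    f x c = \sum_w dl x w * \sum_a f w a * N' a c e'
}.

Section BasedMorphism.
Context (R : realType) (I J : finType)
  (N : I -> I -> I -> R) (e : I) (dl : I -> I -> R)
  (N' : J -> J -> J -> R) (e' : J) (dl' : J -> J -> R) (f : I -> J -> R)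
  (brN : based_ring N e dl) (brN' : based_ring N' e' dl')
  (bmf : based_morphism N e dl N' e' f)
  (d : I -> R) (d_char : positive_character N d)
  (d' : J -> R) (d'_char : positive_character N' d').

(** The unit occurs in w x for some constituent w of the dual of x. If the image of x vanished, so
    would that of w x, whereas the unit maps to the unit. *)
Lemma morphism_neq0 x : exists a, f x a != 0.
Proof.
apply: contrapT => f0; have {}f0 a : f x a = 0.
  by apply/eqP; apply: contrapT => /negP fxa; apply: f0; exists a.
have := oner_neq0 R; rewrite -(dual_mul_unit brN x) => /eqP; apply.
apply: big1 => w _; rewrite (_ : N w x e = 0) ?mulr0 //.
apply/eqP; rewrite eq_le (br_ge0 brN) andbT.
have : \sum_z N w x z * f z e' = 0.
  rewrite (bm_mul bmf) big1 // => a _; apply: big1 => b _.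
  by rewrite f0 mulr0 mul0r.
rewrite (bigD1 e) //= (bm_one bmf) eqxx mulr1 => <-.
by rewrite lerDl sumr_ge0 // => t _; rewrite mulr_ge0 ?(br_ge0 brN) ?(bm_ge0 bmf).
Qed.

(** The pullback of [d'] along [f] is multiplicative, and positive by [morphism_neq0]; the positive
    character is unique. *)
Lemma morphism_character x : \sum_a f x a * d' a = d x.
Proof.
apply: (positive_character_unique brN (d := fun x => \sum_a f x a * d' a) _ d_char).
split=> [z|y z].
  have [a fa] := morphism_neq0 z.
  rewrite (bigD1 a) //= ltr_pwDl ?mulr_gt0 ?(character_gt0 d'_char) //.
    by rewrite lt_def fa (bm_ge0 bmf).
  rewrite sumr_ge0 // => b _.
  by rewrite mulr_ge0 ?(bm_ge0 bmf) // ltW ?(character_gt0 d'_char).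
transitivity (\sum_c (\sum_t N y z t * f t c) * d' c).
  under eq_bigr do rewrite mulr_sumr.
  rewrite exchange_big; apply: eq_bigr => c _; rewrite mulr_suml.
  by apply: eq_bigr => t _; rewrite mulrA.
under eq_bigr do rewrite (bm_mul bmf) mulr_suml.
rewrite exchange_big mulr_suml; apply: eq_bigr => a _ /=.
under eq_bigr do rewrite mulr_suml.
rewrite exchange_big mulr_sumr; apply: eq_bigr => b _ /=.
under eq_bigr do rewrite -mulrA.
by rewrite -mulr_sumr (characterE d'_char); ring.
Qed.

Definition gram x z := \sum_c f x c * f z c.

(** Writing x' for the dual of x, dim Hom(F x, F z) is the multiplicity of the unit in F(x' z).
    Expand x' z into simple constituents t; reciprocity turns the multiplicity of t in x' z into
    that of z in x t. *)
Lemma gramE x z : gram x z = \sum_t f t e' * N x t z.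
Proof.
transitivity (\sum_c \sum_w \sum_a dl x w * (f w a * f z c * N' a c e')).
  apply: eq_bigr => c _; rewrite (bm_dual bmf) mulr_suml; apply: eq_bigr => w _.
  by rewrite mulr_sumr mulr_suml; apply: eq_bigr => a _; ring.
rewrite exchange_big.
transitivity (\sum_w \sum_t dl x w * (N w z t * f t e')).
  apply: eq_bigr => w _; rewrite -mulr_sumr (bm_mul bmf) exchange_big mulr_sumr.
  by apply: eq_bigr => a _; rewrite mulr_sumr.
rewrite exchange_big; apply: eq_bigr => t _.
rewrite (br_dual brN) mulr_sumr; apply: eq_bigr => w _ /=.
by ring.
Qed.

Lemma gramC x z : gram x z = gram z x.
Proof. by apply: eq_bigr => c _; rewrite mulrC. Qed.

(** * Normal morphisms and the vanishing of the Dirichlet energy *)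

Section Normal.
Hypothesis f_normal : forall x a, f x e' != 0 -> a != e' -> f x a = 0.

Let n := \sum_t f t e' ^+ 2.

(** Either the prefactor is zero, or the unit occurs in the image of [t] and normality removes every
    other constituent. *)
Lemma normal_collapse t (g : J -> R) :
  f t e' * \sum_b f t b * g b = f t e' ^+ 2 * g e'.
Proof.
have [->|ft] := eqVneq (f t e') 0; first by rewrite expr2 !mul0r.
rewrite (bigD1 e') //= big1 ?addr0 => [|b /(f_normal ft) ->]; last by rewrite mul0r.
by ring.
Qed.

Lemma gram_morphism x a : \sum_z gram x z * f z a = n * f x a.
Proof.
under eq_bigr do rewrite gramE mulr_suml.
rewrite exchange_big /n mulr_suml; apply: eq_bigr => t _ /=.
under eq_bigr do rewrite -mulrA.
rewrite -mulr_sumr (bm_mul bmf) exchange_big /=.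
under eq_bigr do under eq_bigr do rewrite (mulrC (f x _)) -mulrA.
under eq_bigr do rewrite -mulr_sumr.
rewrite normal_collapse (bigD1 a) //= (br_unitr brN') eqxx mulr1.
rewrite big1 ?addr0 // => b ba.
by rewrite (br_unitr brN') eq_sym (negPf ba) mulr0.
Qed.

Lemma gram_character x : \sum_z gram x z * d z = n * d x.
Proof.
under eq_bigr do rewrite gramE mulr_suml.
rewrite exchange_big /n mulr_suml; apply: eq_bigr => t _ /=.
under eq_bigr do rewrite -mulrA.
rewrite -mulr_sumr (characterE d_char) -(morphism_character t) mulrCA.
by rewrite normal_collapse (character_unit brN' d'_char) mulr1 mulrC.
Qed.

(* Both [d] and [f _ y] are eigenvectors of [gram] for the same eigenvalue, so the Dirichlet
   energy of [f _ y / d] for the conductances [gram x z * d x * d z] vanishes. *)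
Lemma normal_proportional x z a y :
  f x a != 0 -> f z a != 0 -> f x y / d x = f z y / d z.
Proof.
move=> fxa fza; pose g t := f t y / d t.
have dg t : d t * g t = f t y by rewrite mulrC divfK ?lt0r_neq0 ?(character_gt0 d_char).
have gram_ge0 s t : 0 <= gram s t.
  by apply: sumr_ge0 => c _; rewrite mulr_ge0 ?(bm_ge0 bmf).
have gram_xz : gram x z != 0.
  rewrite /gram (bigD1 a) //= lt0r_neq0 // ltr_pwDl ?mulr_gt0 //.
  - by rewrite lt_def fxa (bm_ge0 bmf).
  - by rewrite lt_def fza (bm_ge0 bmf).
  - by rewrite sumr_ge0 // => c _; rewrite mulr_ge0 ?(bm_ge0 bmf).
pose energy s t := gram s t * d s * d t * (g s - g t) ^+ 2.
have energy_ge0 s t : 0 <= energy s t.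
  have d_ge0 r : 0 <= d r by apply/ltW/(character_gt0 d_char).
  exact: mulr_ge0 (mulr_ge0 (mulr_ge0 _ _) _) (sqr_ge0 _).
(* Expand the square: by [gram_character] and the symmetry of [gram], each square term sums to [n]
   times the sum of the [f s y ^+ 2]; by [gram_morphism] so does the cross term, which is subtracted
   twice. *)
have energy0 : \sum_s \sum_t energy s t = 0.
  have sq s : \sum_t gram s t * d s * d t * g s ^+ 2 = n * f s y ^+ 2.
    transitivity (d s * g s ^+ 2 * \sum_t gram s t * d t).
      by rewrite mulr_sumr; apply: eq_bigr => t _; ring.
    by rewrite gram_character -dg; ring.
  have cross s : \sum_t gram s t * d s * d t * (g s * g t) = n * f s y ^+ 2.
    transitivity (f s y * \sum_t gram s t * f t y).
      by rewrite mulr_sumr; apply: eq_bigr => t _; rewrite -!dg; ring.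
    by rewrite gram_morphism; ring.
  transitivity (\sum_s \sum_t gram s t * d s * d t * g s ^+ 2
    + \sum_s \sum_t gram s t * d s * d t * g t ^+ 2
    - 2 * \sum_s \sum_t gram s t * d s * d t * (g s * g t)).
    rewrite mulr_sumr -sumrN -!big_split; apply: eq_bigr => s _ /=.
    rewrite mulr_sumr -sumrN -!big_split; apply: eq_bigr => t _ /=.
    by rewrite /energy; ring.
  rewrite [X in _ + X - _]exchange_big /=.
  under [X in _ + X - _]eq_bigr => t _.
    under eq_bigr => s _ do rewrite gramC (mulrAC _ (d s)).
    rewrite sq; over.
  under eq_bigr do rewrite sq.
  under [X in _ - 2 * X]eq_bigr do rewrite cross.
  by ring.
have energy_xz : energy x z = 0.
  have row_ge0 s : 0 <= \sum_t energy s t by apply: sumr_ge0.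
  have := psumr_eq0P (fun s _ => row_ge0 s) energy0.
  move=> /(_ x isT)/(psumr_eq0P (fun t _ => energy_ge0 x t)).
  exact.
move/eqP: energy_xz; rewrite mulf_eq0 sqrf_eq0 subr_eq0 !mulf_eq0 (negPf gram_xz).
by rewrite (gt_eqF (character_gt0 d_char x)) (gt_eqF (character_gt0 d_char z)) => /eqP.
Qed.

End Normal.

Lemma dominant_regular y :
  (forall a, exists x, f x a != 0) ->
  \sum_x d x * f x y = (\sum_x d x ^+ 2) / (\sum_a d' a ^+ 2) * d' y.
Proof.
move=> f_dom; pose h a := \sum_x d x * f x a; pose m := \sum_x d x ^+ 2.
have h_gt0 a : 0 < h a.
  have [x fxa] := f_dom a.
  rewrite /h (bigD1 x) //= ltr_pwDl ?mulr_gt0 ?(character_gt0 d_char) //.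
    by rewrite lt_def fxa (bm_ge0 bmf).
  rewrite sumr_ge0 // => z _.
  by rewrite mulr_ge0 ?(bm_ge0 bmf) // ltW ?(character_gt0 d_char).
have hd' : \sum_a h a * d' a = m.
  under eq_bigr do rewrite mulr_suml.
  rewrite exchange_big; apply: eq_bigr => x _ /=.
  under eq_bigr do rewrite -mulrA.
  by rewrite -mulr_sumr morphism_character.
(* [Q] is left multiplication by [h]. Its eigenvalue [m] on [d'] is the dimension of [h]; on [h] it
   comes from the regular element of the source, whose square is [m] times itself. *)
pose Q c b := \sum_a h a * N' a b c.
have Q_gt0 c b : 0 < Q c b.
  rewrite lt_def sumr_ge0 ?andbT => [|a _]; last first.
    by rewrite mulr_ge0 ?(br_ge0 brN') // ltW.
  apply/eqP => /psumr_eq0P Q0; have := left_mul_gt0 brN' b c.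
  rewrite big1 ?ltxx // => a _; apply/eqP.
  have /eqP := Q0 (fun t _ => mulr_ge0 (ltW (h_gt0 t)) (br_ge0 brN' _ _ _)) a isT.
  by rewrite mulf_eq0 gt_eqF.
have Qd' c : mapp Q d' c = m * d' c.
  rewrite /mapp; under eq_bigr do rewrite mulr_suml.
  rewrite exchange_big -hd' mulr_suml; apply: eq_bigr => a _ /=.
  under eq_bigr do rewrite -mulrA.
  by rewrite -mulr_sumr (character_eigen brN' d'_char) mulrA.
have Qh c : mapp Q h c = m * h c.
  transitivity (\sum_x \sum_z d x * d z * \sum_a \sum_b f x a * f z b * N' a b c).
    transitivity (\sum_b \sum_a \sum_x \sum_z d x * d z * (f x a * f z b * N' a b c)).
      apply: eq_bigr => b _; rewrite mulr_suml; apply: eq_bigr => a _.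
      rewrite -mulrA mulr_suml; apply: eq_bigr => x _; rewrite !mulr_sumr.
      by apply: eq_bigr => z _; ring.
    under eq_bigr do rewrite exchange_big.
    rewrite exchange_big; apply: eq_bigr => x _ /=.
    under eq_bigr do rewrite exchange_big.
    rewrite exchange_big; apply: eq_bigr => z _ /=.
    by rewrite exchange_big mulr_sumr; apply: eq_bigr => a _; rewrite mulr_sumr.
  rewrite /m mulr_suml; apply: eq_bigr => x _.
  under eq_bigr do rewrite -(bm_mul bmf) mulr_sumr.
  rewrite exchange_big /h mulr_sumr; apply: eq_bigr => t _ /=.
  transitivity (d x * f t c * \sum_z N x z t * d z).
    by rewrite mulr_sumr; apply: eq_bigr => z _; ring.
  by rewrite (character_eigen brN d_char); ring.
have [c hE] := positive_eigen_unique Q_gt0 (character_gt0 d'_char) Qd' Qh.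
rewrite -/(h y) hE; congr (_ * _).
(* Pairing [h = c * d'] with [d'] determines [c], since the left side becomes [m]. *)
apply: (canRL (mulfK (lt0r_neq0 (character_sqr_gt0 e' d'_char)))).
rewrite -/m -hd' mulr_sumr.
by apply: eq_bigr => a _; rewrite hE; ring.
Qed.

End BasedMorphism.

(** * The Grothendieck ring *)

Local Open Scope complex_scope.

Section Grothendieck.
Context (R : realType) (k : fieldType) (C : fusionCat k).
Implicit Types (X Y Z : Irr C).

Definition fusionR X Y Z : R := (fusion X Y Z)%:R.

Local Notation N := fusionR.

Lemma fusion_based_ring :
  based_ring N (one_irr C) (fun X Y => (mult Y (codual X))%:R).
Proof.
split=> [X Y Z|X Y|X Y Z T|X Y|X Y|X Y Z]; rewrite /fusionR ?ler0n //.
- under eq_bigr do rewrite -natrM; under [RHS]eq_bigr do rewrite -natrM.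
  by rewrite -!natr_sum fusion_assoc.
- by rewrite fusion_unitl.
- by rewrite fusion_unitr.
- by under eq_bigr do rewrite -natrM; rewrite -natr_sum fusion_dual.
Qed.

Lemma K0classE (V : C) X : K0class R V X = (mult X V)%:R.
Proof. by rewrite ffunE dimvf. Qed.

Lemma K0_sumE (I : finType) (P : pred I) (v : I -> K0 R C) Z :
  (\sum_(i | P i) v i) Z = \sum_(i | P i) (v i Z : R[i]).
Proof.
apply: (big_morph (fun u : K0 R C => u Z : R[i])) => [u w|].
  by rewrite ffunE.
by rewrite ffunE.
Qed.

Lemma K0_scaleE (a : R[i]) (v : K0 R C) Z : (a *: v) Z = a * v Z.
Proof. by rewrite ffunE. Qed.

Lemma K0mul_basisE X (v : K0 R C) Z :
  K0mul (K0basis R X) v Z = \sum_Y (N X Y Z)%:C * v Y.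
Proof.
rewrite /K0mul K0_sumE (bigD1 X) //= [S in _ + S]big1 ?addr0 => [|X' /negPf X'X].
  rewrite K0_sumE; apply: eq_bigr => Y _.
  by rewrite K0_scaleE K0classE ffunE eqxx mul1r rmorph_nat mulrC.
rewrite K0_sumE; apply: big1 => Y _.
by rewrite K0_scaleE ffunE X'X !mul0r.
Qed.

(** The vector [d] shows that [d X] is an eigenvalue. For an upper bound, the absolute values of a
    complex eigenvector form a nonnegative subeigenvector, to which [character_eigen_le] applies. *)
Lemma FPdim_irrE (d : Irr C -> R) X : positive_character N d -> FPdim_irr R X = d X.
Proof.
move=> d_char; have brN := fusion_based_ring.
have d_ge0 Y : 0 <= d Y by apply/ltW/(character_gt0 d_char).
rewrite /FPdim_irr; set E := (S in sup S).
have dE : E (d X).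
  split=> //; exists [ffun Y => (d Y)%:C]; split.
    apply/eqP => /ffunP/(_ X); rewrite !ffunE => /eqP.
    by rewrite fmorph_eq0 gt_eqF // (character_gt0 d_char).
  apply/ffunP => Z; rewrite K0mul_basisE ffunE.
  under eq_bigr do rewrite ffunE -rmorphM.
  by rewrite -rmorph_sum (character_eigen brN d_char) rmorphM ffunE.
have E_ub : ubound E (d X).
  move=> a [a_ge0 [v [v0 /ffunP vE]]].
  pose u Y := complex.Re `|v Y|.
  have uE Y : (u Y)%:C = `|v Y| by rewrite /u RRe_real // normr_real.
  apply: (character_eigen_le d_char (u := u)) => [Y||Z].
  - by rewrite -lecR uE normr_ge0.
  - apply: contrapT => u0; case/negP: v0; apply/eqP/ffunP => Y; rewrite ffunE.
    apply/eqP; rewrite -normr_eq0 -uE fmorph_eq0.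
    by apply: contrapT => /negP uY; apply: u0; exists Y.
  - rewrite -lecR rmorphM rmorph_sum /= uE.
    have -> : a%:C * `|v Z| = `|\sum_Y (N X Y Z)%:C * v Y|.
      rewrite -K0mul_basisE vE ffunE normrM ger0_norm //.
      by rewrite -[0]/(0%:C) lecR.
    apply: le_trans (ler_norm_sum _ _ _) _; apply: ler_sum => Y _.
    rewrite normrM rmorphM /= uE ger0_norm // -[0]/(0%:C) lecR.
    by rewrite ler0n.
apply/eqP; rewrite eq_le; apply/andP; split.
  by apply: ge_sup E_ub; exists (d X).
by apply: ub_le_sup dE; exists (d X).
Qed.

Lemma FPdim_irr_character : positive_character N (@FPdim_irr R k C).
Proof.
have [d d_char] := positive_character_exists fusion_based_ring.
rewrite (_ : @FPdim_irr R k C = d) //.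
by apply/funext => X; apply: FPdim_irrE.
Qed.

Lemma regular_eltE (A : {set Irr C}) X :
  regular_elt R A X = ((X \in A)%:R * FPdim_irr R X)%:C.
Proof.
rewrite /regular_elt K0_sumE; case: (boolP (X \in A)) => XA.
  rewrite (bigD1 X) //= [S in _ + S]big1 ?addr0 => [|Y /andP[_ /negPf YX]].
    by rewrite !ffunE eqxx mul1r; exact: mulr1.
  by rewrite !ffunE eq_sym YX; exact: mulr0.
rewrite mul0r big1 // => Y YA; rewrite !ffunE.
by rewrite (negPf (_ : X != Y)); [exact: mulr0|apply: contraNneq XA => ->].
Qed.

Lemma FPdim_regular_elt (A : {set Irr C}) :
  FPdim (regular_elt R A) = (\sum_(X in A) FPdim_irr R X ^+ 2)%:C.
Proof.
rewrite /FPdim rmorph_sum /= [RHS]big_mkcond; apply: eq_bigr => X _.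
rewrite regular_eltE -rmorphM; case: (X \in A); first by rewrite mul1r.
by rewrite !mul0r.
Qed.

End Grothendieck.

Lemma enumerates_classesP (T : finType) (r : rel T) l (A : 'I_l -> {set T}) i x y :
  symmetric r -> transitive r -> enumerates_classes r A ->
  x \in A i -> (y \in A i) = r x y.
Proof.
move=> r_sym r_trans [_ A_eq] xA.
have : A i \in equivalence_partition r [set: T].
  by rewrite -A_eq; apply: imset_f.
case/imsetP=> z _ Ai; move: xA; rewrite Ai !inE /= => zx.
by apply/idP/idP => [zy|]; [apply: r_trans zy; rewrite r_sym|apply: r_trans zx].
Qed.

(** * The action of a tensor functor on Grothendieck groups *)

Section TensorFunctor.
Context (R : realType) (k : fieldType) (C D : fusionCat k)
  (F : tensorFunctor C D).
Implicit Types (X Y Z : Irr C) (a b : Irr D).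

Local Notation dC := (@FPdim_irr R k C).
Local Notation dD := (@FPdim_irr R k D).

Definition branchingR X a : R := (branching F X a)%:R.

Local Notation f := branchingR.

Lemma branching_based_morphism :
  based_morphism (@fusionR R k C) (one_irr C)
    (fun X Y => (mult Y (codual X))%:R) (@fusionR R k D) (one_irr D) f.
Proof.
split=> [X a|X Y c|a|X c]; rewrite /branchingR /fusionR ?ler0n //.
- under eq_bigr do rewrite -natrM; rewrite -natr_sum branching_tens natr_sum.
  apply: eq_bigr => a _; rewrite natr_sum; apply: eq_bigr => b _.
  by rewrite !natrM.
- by rewrite branching_one.
- rewrite branching_dual natr_sum; apply: eq_bigr => Y _; rewrite natrM natr_sum.
  by congr (_ * _); apply: eq_bigr => a _; rewrite natrM.
Qed.

Lemma sim_upP X Y :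
  reflect (exists a, f X a != 0 /\ f Y a != 0) (sim_up F X Y).
Proof.
apply: (iffP (set0Pn _)) => [] [a]; rewrite ?in_setI ?mem_up1.
  by case/andP=> Xa Ya; exists a; rewrite /branchingR !pnatr_eq0.
by rewrite /branchingR !pnatr_eq0 => -[Xa Ya]; exists a; rewrite in_setI !mem_up1 Xa Ya.
Qed.

Lemma sim_downP a b :
  reflect (exists X, f X a != 0 /\ f X b != 0) (sim_down F a b).
Proof.
apply: (iffP (set0Pn _)) => [] [X]; rewrite ?in_setI ?mem_down1.
  by case/andP=> Xa Xb; exists X; rewrite /branchingR !pnatr_eq0.
by rewrite /branchingR !pnatr_eq0 => -[Xa Xb]; exists X; rewrite in_setI !mem_down1 Xa Xb.
Qed.

Lemma approx_up_sym : symmetric (approx_up F).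
Proof.
have sym X Y : approx_up F X Y -> approx_up F Y X.
  move/asboolP => XY; apply/asboolP; elim: XY => {X Y} [X Y|X Y Z _ YX _ ZY].
    by rewrite /sim_up setIC => XY; apply: t_step.
  exact: t_trans ZY YX.
by move=> X Y; apply/idP/idP; apply: sym.
Qed.

Lemma approx_up_trans : transitive (approx_up F).
Proof.
by move=> Y X Z /asboolP XY /asboolP YZ; apply/asboolP; apply: t_trans XY YZ.
Qed.

(** A transitive closure is not reflexive by construction; here F(X) has a simple constituent, so
    one step leads from [X] to itself. *)
Lemma approx_up_refl X : approx_up F X X.
Proof.
have [a fa] := morphism_neq0 (fusion_based_ring R C) branching_based_morphism X.
by apply/asboolP/t_step/sim_upP; exists a.
Qed.

Lemma FPdim_irr_gt0 X : 0 < dC X.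
Proof. exact: (character_gt0 (FPdim_irr_character R C)). Qed.

Lemma approx_up_proportional X Y a :
  normal F -> approx_up F X Y -> f X a / dC X = f Y a / dC Y.
Proof.
move=> F_normal /asboolP; elim=> {X Y} [X Y XY|X Y Z _ XY _ YZ]; last first.
  exact (etrans XY YZ).
have /sim_upP[b [Xb Yb]] := XY.
apply: (normal_proportional (fusion_based_ring R C) (fusion_based_ring R D)
  branching_based_morphism (FPdim_irr_character R C) (FPdim_irr_character R D)
  _ _ Xb Yb) => Z c; rewrite /branchingR !pnatr_eq0 => Z1 c1.
by rewrite normal_branching.
Qed.

Lemma pushforwardE (v : K0 R C) a :
  pushforward F v a = \sum_X v X * (f X a)%:C.
Proof.
rewrite /pushforward K0_sumE; apply: eq_bigr => X _.
by rewrite K0_scaleE K0classE /branchingR rmorph_nat.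
Qed.

Lemma pushforward_basisE X a : pushforward F (K0basis R X) a = (f X a)%:C.
Proof.
rewrite pushforwardE (bigD1 X) //= ffunE eqxx mul1r big1 ?addr0 // => Y YX.
by rewrite ffunE (negPf YX) mul0r.
Qed.

(** The adjunction makes the matrix of [G] the transpose of that of [F]: statements on [G] concern
    columns of [f], those on [F] its rows. *)
Lemma pushforward_right_adjointE (G : linFunctor D C) a X :
  is_right_adjoint F G -> pushforward G (K0basis R a) X = (f X a)%:C.
Proof.
move=> G_adj; rewrite /pushforward K0_sumE (bigD1 a) //=.
rewrite K0_scaleE ffunE eqxx mul1r K0classE (right_adjoint_mult _ _ G_adj).
rewrite big1 ?addr0 => [|b ba]; first by rewrite rmorph_nat.
by rewrite K0_scaleE ffunE (negPf ba) mul0r.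
Qed.

Lemma normalized_pushforwardE X a :
  (((dC X)%:C)^-1 *: pushforward F (K0basis R X)) a = (f X a / dC X)%:C.
Proof. by rewrite K0_scaleE pushforward_basisE fmorph_div mulrC. Qed.

Lemma normalized_right_adjointE (G : linFunctor D C) a X :
  is_right_adjoint F G ->
  (((dD a)%:C)^-1 *: pushforward G (K0basis R a)) X = (f X a / dD a)%:C.
Proof.
by move=> G_adj; rewrite K0_scaleE pushforward_right_adjointE // fmorph_div mulrC.
Qed.

(* Together with [approx_up_proportional], this gives [R_! [Y]] up to the scalar that is then
   determined by [sum_X d X * f X Y = [C : D] * d Y]. *)
Lemma branching_dominant (A : {set Irr C}) X a :
  normal F -> dominant F ->
  (forall Y, Y \in A -> forall Z, (Z \in A) = approx_up F Y Z) ->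
  X \in A -> f X a != 0 ->
  forall Y, f Y a / dD a =
    FPindex R C D / (\sum_(Z in A) dC Z ^+ 2) * ((Y \in A)%:R * dC Y).
Proof.
move=> F_normal F_dom A_class XA Xa Y.
have dA_gt0 : 0 < \sum_(Z in A) dC Z ^+ 2.
  rewrite (bigD1 X) //= ltr_pwDl ?exprn_gt0 ?FPdim_irr_gt0 //.
  by apply: sumr_ge0 => Z _; apply: sqr_ge0.
have outA Z : Z \notin A -> f Z a = 0.
  move=> ZA; apply/eqP; apply: contraNT ZA => Za; rewrite (A_class X XA).
  by apply/asboolP/t_step/sim_upP; exists a.
have [YA|YA] := boolP (Y \in A); last by rewrite outA // !mul0r mulr0.
have inA Z : Z \in A -> f Z a = dC Z * (f Y a / dC Y).
  rewrite (A_class Y YA) => YZ; rewrite (approx_up_proportional _ F_normal YZ).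
  by rewrite mulrC divfK // lt0r_neq0 ?FPdim_irr_gt0.
have a_gt0 : 0 < dD a := character_gt0 (FPdim_irr_character R D) a.
have : \sum_Z dC Z * f Z a = FPindex R C D * dD a.
  apply: (dominant_regular (fusion_based_ring R C) (fusion_based_ring R D)
    branching_based_morphism (FPdim_irr_character R C) (FPdim_irr_character R D)).
  move=> b; have [Z Zb] := (dominantP F).1 F_dom b.
  by exists Z; rewrite /branchingR pnatr_eq0.
rewrite (bigID (mem A)) /= [S in _ + S]big1 ?addr0 => [|Z ZA]; last first.
  by rewrite outA ?mulr0.
under eq_bigr => Z ZA do rewrite inA // mulrA -expr2.
rewrite -mulr_suml => e.
have -> : FPindex R C D =
    (\sum_(Z in A) dC Z ^+ 2) * (f Y a / dC Y) / dD a.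
  by rewrite e mulfK // gt_eqF.
have dY := FPdim_irr_gt0 Y.
by field; rewrite !gt_eqF.
Qed.

End TensorFunctor.

Theorem theorem4p4 (R : realType) (k : fieldType) (C D : fusionCat k)
    (F : tensorFunctor C D) (G : linFunctor D C)
    (F_normal : normal F) (G_adj : is_right_adjoint F G)
    (l : nat) (A : 'I_l -> {set Irr C})
    (A_classes : enumerates_classes (approx_up F) A) :
  [/\ forall (i : 'I_l) (X : Irr C), X \in A i ->
        ((FPdim_irr R X)%:C)^-1 *: pushforward F (K0basis R X) =
        (FPdim (regular_elt R (A i)))^-1 *: pushforward F (regular_elt R (A i)),
      forall X X' : Irr C,
        approx_up F X X' <->
        ((FPdim_irr R X)%:C)^-1 *: pushforward F (K0basis R X) =
        ((FPdim_irr R X')%:C)^-1 *: pushforward F (K0basis R X')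
    & dominant F ->
      (forall B : 'I_l -> {set Irr D},
         enumerates_classes (approx_down F) B ->
         (forall i, B i = up F (A i)) ->
         forall (i : 'I_l) (Y : Irr D), Y \in B i ->
           ((FPdim_irr R Y)%:C)^-1 *: pushforward G (K0basis R Y) =
           ((FPindex R C D)%:C / FPdim (regular_elt R (A i))) *:
             regular_elt R (A i)) /\
      (forall Y Y' : Irr D,
         approx_down F Y Y' <->
         ((FPdim_irr R Y)%:C)^-1 *: pushforward G (K0basis R Y) =
         ((FPdim_irr R Y')%:C)^-1 *: pushforward G (K0basis R Y'))].
Proof.
have d_gt0 (X : Irr C) : 0 < FPdim_irr R X by apply: FPdim_irr_gt0.
have d_gt0' (a : Irr D) : 0 < FPdim_irr R a by apply: FPdim_irr_gt0.
have A_class i X : X \in A i -> forall Y, (Y \in A i) = approx_up F X Y.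
  move=> XA Y; apply: enumerates_classesP A_classes XA.
    exact: approx_up_sym.
  exact: approx_up_trans.
have F_neq0 (X : Irr C) : exists a, branchingR R F X a != 0.
  exact: morphism_neq0 (fusion_based_ring R C) (branching_based_morphism R F) X.
split=> [i X XA|X X'|F_dom].
- apply/ffunP => a; rewrite FPdim_regular_elt.
  rewrite normalized_pushforwardE.
  have FA : pushforward F (regular_elt R (A i)) a =
      (\sum_(Z in A i) FPdim_irr R Z * branchingR R F Z a)%:C.
    rewrite pushforwardE rmorph_sum /= [RHS]big_mkcond; apply: eq_bigr => Z _.
    rewrite regular_eltE -rmorphM; case: (Z \in A i); first by rewrite mul1r.
    by rewrite !mul0r.
  rewrite K0_scaleE FA [RHS]mulrC -fmorph_div; congr _%:C.
  have dA_gt0 : 0 < \sum_(Z in A i) FPdim_irr R Z ^+ 2.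
    rewrite (bigD1 X) //= ltr_pwDl ?exprn_gt0 //.
    by apply: sumr_ge0 => Z _; apply: sqr_ge0.
  (* On the class of [X], [f Z a] is the constant [f X a / FPdim_irr R X] times [FPdim_irr R Z], so
     the sum is that constant times the sum of squares. *)
  apply: (canRL (mulfK (lt0r_neq0 dA_gt0))); rewrite mulr_sumr.
  apply: eq_bigr => Z; rewrite (A_class i X XA) => XZ.
  rewrite (approx_up_proportional R a F_normal XZ) mulrC expr2 -mulrA.
  by congr (_ * _); rewrite mulrC divfK ?lt0r_neq0.
- split=> [XX'|/ffunP e].
    apply/ffunP => a.
    rewrite [LHS]normalized_pushforwardE [RHS]normalized_pushforwardE.
    by rewrite (approx_up_proportional R a F_normal XX').
  (* Proportional rows have the same support, so any constituent of F(X) is one of F(X'), and a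
     single step of [sim_up] links them. *)
  have [a Xa] := F_neq0 X.
  have := e a; rewrite [LHS]normalized_pushforwardE [RHS]normalized_pushforwardE.
  move/complexI => Xa_X'a; apply/asboolP/t_step/(sim_upP R); exists a.
  split; first exact Xa.
  apply: contraNneq Xa => X'a.
  move/eqP: Xa_X'a; rewrite X'a mul0r mulf_eq0 invr_eq0.
  by rewrite (gt_eqF (d_gt0 X)) orbF.
split=> [B _ B_up i Y|Y Y'].
  rewrite B_up => /bigcupP[X0 X0A]; rewrite mem_up1 => X0Y.
  apply/ffunP => X; rewrite FPdim_regular_elt.
  rewrite (normalized_right_adjointE _ _ _ G_adj).
  rewrite K0_scaleE regular_eltE -fmorph_div -rmorphM; congr _%:C.
  by apply: (branching_dominant F_normal F_dom (A_class i) X0A); rewrite /branchingR pnatr_eq0.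
split=> [/asboolP|/ffunP e].
  elim=> {Y Y'} [Y Y' YY'|Y Y' Y'' _ YY' _ Y'Y'']; last exact (etrans YY' Y'Y'').
  have /(sim_downP R)[X0 [X0Y X0Y']] := YY'.
  (* After normalization, a column meeting the class of [X0] depends only on that class, and the
     columns of [Y] and [Y'] both meet it at [X0]. *)
  pose A0 := [set Z | approx_up F X0 Z].
  have A0_class Z : Z \in A0 -> forall Z', (Z' \in A0) = approx_up F Z Z'.
    rewrite inE => X0Z Z'; rewrite inE.
    by apply/idP/idP; apply: approx_up_trans; rewrite // approx_up_sym.
  have X0A0 : X0 \in A0 by rewrite inE (approx_up_refl R).
  apply/ffunP => X.
  rewrite [LHS](normalized_right_adjointE _ _ _ G_adj)
  [RHS](normalized_right_adjointE _ _ _ G_adj).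
  by rewrite !(branching_dominant F_normal F_dom A0_class X0A0).
(* The same support argument, for columns; dominance ensures that the column of [Y] is nonzero. *)
have [X XY] := (dominantP F).1 F_dom Y.
have := e X; rewrite [LHS](normalized_right_adjointE _ _ _ G_adj)
  [RHS](normalized_right_adjointE _ _ _ G_adj).
have {}XY : branchingR R F X Y != 0 by rewrite /branchingR pnatr_eq0.
move/complexI => XY_XY'; apply/asboolP/t_step/(sim_downP R); exists X.
split; first exact XY.
apply: contraNneq XY => XY'.
move/eqP: XY_XY'; rewrite XY' mul0r mulf_eq0 invr_eq0.
by rewrite (gt_eqF (d_gt0' Y)) orbF.
Qed.
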